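(* For $\mathcal{EL}_\bot$ weighted knowledge bases, the problems $\mathsf{I}^{p}_{opt}$ and $\mathsf{I}^{c}_{opt}$ (optimal-cost possible and certain instance query entailment) are ExpTime-hard in combined complexity, even if the weights are encoded in unary.
   Context: Fix pairwise disjoint countably infinite sets $\mathsf{N_C}$, $\mathsf{N_R}$, $\mathsf{N_I}$ of concept, role and individual names. $\mathcal{EL}_\bot$ concepts: $C ::= A \mid \top\mid\bot\mid C\sqcap C\mid \exists R.C$. A TBox is a finite set of concept inclusions $C\sqsubseteq D$; an ABox is a finite set of assertions $A(a)$, $R(a,b)$. Interpretations $\mathcal I=(\Delta^{\mathcal I},\cdot^{\mathcal I})$ have the usual semantics under a weak standard names assumption: individual names occurring in the input are interpreted as themselves, $a^{\mathcal I}=a\in\Delta^{\mathcal I}$. A weighted knowledge base (WKB) is $\mathcal K_\omega=(\langle\mathcal T,\mathcal A\rangle,\omega)$ with $\omega:\mathcal T\cup\mathcal A\to\mathbb N_{>0}\cup\{\infty\}$. For $\tau=B\sqsubseteq C$ let $\mathrm{vio}_\tau(\mathcal I)=(B\sqcap\neg C)^{\mathcal I}$ and $\mathrm{vio}_{\mathcal A}(\mathcal I)=\{\alpha\in\mathcal A\mid\mathcal I\not\models\alpha\}$. $\mathrm{cost}_{\mathcal K_\omega}(\mathcal I)=\sum_{\tau\in\mathcal T}\omega(\tau)|\mathrm{vio}_\tau(\mathcal I)|+\sum_{\alpha\in\mathrm{vio}_{\mathcal A}(\mathcal I)}\omega(\alpha)$ (summands with empty violation set are $0$; cost $\infty$ if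 an infinite-weight element is violated or some violation set is infinite). $\mathrm{optc}(\mathcal K_\omega)=\min_{\mathcal I}\mathrm{cost}_{\mathcal K_\omega}(\mathcal I)$. An instance query is a Boolean query consisting of a single atom $A(t)$ or $R(t,t')$; $\mathcal I\models q$ iff some map from terms to $\Delta^{\mathcal I}$, identity on individuals, makes the atom true. $\mathcal K_\omega\models^c_{opt} q$ iff every $\mathcal I$ with cost $=\mathrm{optc}(\mathcal K_\omega)$ satisfies $q$; $\mathcal K_\omega\models^p_{opt} q$ iff some such $\mathcal I$ satisfies $q$. $\mathsf I^c_{opt}$ (resp. $\mathsf I^p_{opt}$): given $\mathcal K_\omega$ and an instance query $q$, decide $\mathcal K_\omega\models^c_{opt} q$ (resp. $\models^p_{opt}$). Combined complexity measures in the size of the whole input. *)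

(* Defs.v *)
From HB Require Import structures.
From mathcomp Require Import all_boot all_order all_algebra.
From mathcomp Require Import mathcomp_extra boolp classical_sets functions.
From mathcomp Require Import cardinality constructive_ereal.

Set Implicit Arguments.
Unset Strict Implicit.
Unset Printing Implicit Defensive.

Definition word := seq bool.
Definition language := set word.

(** * Deterministic multi-tape Turing machines *)

(* Tape symbols over the work alphabet [G]: [None] is the blank, [Some (inl b)]
   an input/output bit, [Some (inr g)] an additional work symbol. *)
Definition symbol (G : Type) : Type := option (bool + G).

Inductive direction := GoLeft | Stay | GoRight.

(* A two-way infinite tape.  [tleft] lists the cells to the left of the head,
   nearest first; cells beyond the end of [tleft] or [tright] are blank. *)
Record tape (G : Type) := Tape {
  tleft : seq (symbol G);
  thead : symbol G;
  tright : seq (symbol G) }.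

Definition tape_write G (s : symbol G) (t : tape G) : tape G :=
  Tape (tleft t) s (tright t).

Definition tape_move G (d : direction) (t : tape G) : tape G :=
  match d with
  | GoLeft =>
      Tape (behead (tleft t)) (head None (tleft t)) (thead t :: tright t)
  | Stay => t
  | GoRight =>
      Tape (thead t :: tleft t) (head None (tright t)) (behead (tright t))
  end.

Definition blank_tape G : tape G := Tape [::] None [::].

(* The head scans the first letter of [w]. *)
Definition word_tape G (w : word) : tape G :=
  let s := [seq Some (inl b) | b <- w] in
  Tape [::] (head None s) (behead s).

Fixpoint leading_bits G (s : seq (symbol G)) : word :=
  if s is Some (inl b) :: s' then b :: leading_bits s' else [::].

(* The maximal block of bits that starts at the head and extends to its right. *)
Definition tape_word G (t : tape G) : word := leading_bits (thead t :: tright t).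

(* The machine has [tm_extra.+1] tapes: the first one holds the input, the last
   one the output. *)
Record turing_machine := TuringMachine {
  tm_extra : nat;
  tm_state : finType;
  tm_work : finType;
  tm_start : tm_state;
  tm_halt : pred tm_state;
  tm_accept : pred tm_state;
  tm_delta : tm_state -> {ffun 'I_tm_extra.+1 -> symbol tm_work} ->
    tm_state * {ffun 'I_tm_extra.+1 -> symbol tm_work * direction} }.

Record config (M : turing_machine) := Config {
  cf_state : tm_state M;
  cf_tapes : 'I_(tm_extra M).+1 -> tape (tm_work M) }.

Definition tm_init (M : turing_machine) (w : word) : config M :=
  Config (tm_start M) (fun i => if i == ord0 then word_tape _ w else blank_tape _).

Definition tm_step (M : turing_machine) (c : config M) : config M :=
  if tm_halt (cf_state c) then c else
  let: (q, act) := tm_delta (cf_state c) [ffun i => thead (cf_tapes c i)] in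
  Config q (fun i => tape_move (act i).2 (tape_write (act i).1 (cf_tapes c i))).

Definition tm_run (M : turing_machine) (n : nat) (w : word) : config M :=
  iter n (@tm_step M) (tm_init M w).

Definition decides_in_time (M : turing_machine) (L : language) (T : nat -> nat) :=
  forall w, let c := tm_run M (T (size w)) w in
    tm_halt (cf_state c) /\ (tm_accept (cf_state c) <-> L w).

Definition computes_in_time (M : turing_machine) (f : word -> word)
    (T : nat -> nat) :=
  forall w, let c := tm_run M (T (size w)) w in
    tm_halt (cf_state c) /\ tape_word (cf_tapes c ord_max) = f w.

Definition in_exptime (L : language) : Prop :=
  exists (M : turing_machine) (c d : nat),
    decides_in_time M L (fun n => 2 ^ (c * n ^ d + c)).

Definition polytime (f : word -> word) : Prop :=
  exists (M : turing_machine) (c d : nat),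
    computes_in_time M f (fun n => c * n ^ d + c).

Definition polytime_reducible (L P : language) : Prop :=
  exists2 f : word -> word, polytime f & forall w, L w <-> P (f w).

Definition exptime_hard (P : language) : Prop :=
  forall L : language, in_exptime L -> polytime_reducible L P.

(** * Syntax of EL_bot weighted knowledge bases *)

(* Names are words, so that the input size accounts for them.  The sets of
   concept, role and individual names (and of query variables) are disjoint in
   that they are distinct syntactic sorts: no construction below confuses them. *)
Definition cname := word.
Definition rname := word.
Definition iname := word.
Definition vname := word.

Inductive concept :=
| CName of cname
| CTop
| CBot
| CAnd of concept & concept
| CEx of rname & concept.

Inductive assertion :=
| AConcept of cname & iname
| ARole of rname & iname & iname.

Lemma concept_comparable : comparable concept.
Proof. by rewrite /comparable /decidable; do !decide equality. Qed.
HB.instance Definition _ :=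
  hasDecEq.Build concept (compareP concept_comparable).

Lemma assertion_comparable : comparable assertion.
Proof. by rewrite /comparable /decidable; do !decide equality. Qed.
HB.instance Definition _ :=
  hasDecEq.Build assertion (compareP assertion_comparable).

(* [(C, D)] stands for the inclusion of [C] in [D]. *)
Definition inclusion : Type := concept * concept.

(* [None] is the infinite weight. *)
Definition weight := option nat.

(* The finite sets T and A together with the graph of the weight function. *)
Record wkb := WKB {
  tbox : seq (inclusion * weight);
  abox : seq (assertion * weight) }.

Definition weight_ok (w : weight) : bool := w != Some 0.

Definition wf_wkb (K : wkb) : bool :=
  [&& uniq (unzip1 (tbox K)), all weight_ok (unzip2 (tbox K)),
      uniq (unzip1 (abox K)) & all weight_ok (unzip2 (abox K))].

Inductive term := TVar of vname | TInd of iname.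

Lemma term_comparable : comparable term.
Proof. by rewrite /comparable /decidable; do !decide equality. Qed.
HB.instance Definition _ := hasDecEq.Build term (compareP term_comparable).

(* A variable is implicitly existentially quantified. *)
Inductive iquery :=
| QConcept of cname & term
| QRole of rname & term & term.

Definition assertion_inds (a : assertion) : seq iname :=
  match a with AConcept _ a => [:: a] | ARole _ a b => [:: a; b] end.

Definition query_terms (q : iquery) : seq term :=
  match q with QConcept _ t => [:: t] | QRole _ t u => [:: t; u] end.

Definition term_inds (t : term) : seq iname :=
  if t is TInd a then [:: a] else [::].

Definition input_inds (K : wkb) (q : iquery) : seq iname :=
  flatten [seq assertion_inds a.1 | a <- abox K] ++
  flatten [seq term_inds t | t <- query_terms q].

(** * Semantics *)

(* The domain is a set whose elements are individual names or anonymous objects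
   of an arbitrary type, so that a name [a] can literally be the element [inl a]. *)
Record interp := Interp {
  anon : Type;
  dom : set (iname + anon);
  cint : cname -> set (iname + anon);
  rint : rname -> set ((iname + anon) * (iname + anon));
  dom_nonempty : (dom !=set0)%classic;
  cint_dom : forall A, (cint A `<=` dom)%classic;
  rint_dom : forall R, (rint R `<=` dom `*` dom)%classic }.

Arguments dom : clear implicits.
Arguments cint : clear implicits.
Arguments rint : clear implicits.

Definition elt (I : interp) : Type := (iname + anon I)%type.

Definition ind_elt (I : interp) (a : iname) : elt I := inl a.

(* Weak standard names assumption for the names in [N]. *)
Definition standard_names (N : seq iname) (I : interp) : Prop :=
  forall a, a \in N -> dom I (ind_elt I a).

Local Open Scope classical_set_scope.

Fixpoint cext (I : interp) (C : concept) : set (elt I) :=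
  match C with
  | CName A => cint I A
  | CTop => dom I
  | CBot => set0
  | CAnd C1 C2 => @cext I C1 `&` @cext I C2
  | CEx R C1 => [set x | exists2 y, rint I R (x, y) & @cext I C1 y]
  end.

Arguments cext : clear implicits.

Definition vio_inclusion (I : interp) (t : inclusion) : set (elt I) :=
  cext I t.1 `&` (dom I `\` cext I t.2).

Arguments vio_inclusion : clear implicits.

Definition sat_assertion (I : interp) (a : assertion) : Prop :=
  match a with
  | AConcept A a => cint I A (ind_elt I a)
  | ARole R a b => rint I R (ind_elt I a, ind_elt I b)
  end.

Definition sat_atom (I : interp) (pi : term -> elt I) (q : iquery) : Prop :=
  match q with
  | QConcept A t => cint I A (pi t)
  | QRole R t u => rint I R (pi t, pi u)
  end.

Definition sat_query (I : interp) (q : iquery) : Prop :=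
  exists pi : term -> elt I,
    [/\ forall t, t \in query_terms q -> dom I (pi t),
        forall a, TInd a \in query_terms q -> pi (TInd a) = ind_elt I a
      & sat_atom pi q].

Definition ecard (T : Type) (A : set T) : \bar int :=
  if pselect (exists n, (A #= `I_n)%card) is left h then (Posz (projT1 (cid h)))%:E
  else +oo%E.

Definition weight_val (w : weight) : \bar int :=
  if w is Some n then (Posz n)%:E else +oo%E.

(* The product satisfies [+oo * 0 = 0]: an inclusion of infinite weight without
   violation costs nothing. *)
Definition cost (K : wkb) (I : interp) : \bar int :=
  (\sum_(p <- tbox K) weight_val p.2 * ecard (vio_inclusion I p.1) +
  \sum_(p <- abox K | ~~ `[< sat_assertion I p.1 >]) weight_val p.2)%E.

(* [c] is the minimal cost over the interpretations that interpret the names in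
   [N] as themselves. *)
Definition is_optc (N : seq iname) (K : wkb) (c : \bar int) : Prop :=
  (exists2 I, standard_names N I & cost K I = c) /\
  (forall I, standard_names N I -> (c <= cost K I)%E).

Definition optimal (N : seq iname) (K : wkb) (I : interp) : Prop :=
  standard_names N I /\ is_optc N K (cost K I).

Definition entails_certain (K : wkb) (q : iquery) : Prop :=
  forall I, optimal (input_inds K q) K I -> sat_query I q.

Definition entails_possible (K : wkb) (q : iquery) : Prop :=
  exists2 I, optimal (input_inds K q) K I & sat_query I q.

(** * Instances as words *)

Inductive weight_coding := Unary | Binary.

Definition enc_word (w : word) : word :=
  flatten [seq [:: true; b] | b <- w] ++ [:: false].

Definition enc_seq (T : Type) (e : T -> word) (s : seq T) : word :=
  flatten [seq true :: e x | x <- s] ++ [:: false].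

(* Binary digits, least significant first. *)
Definition bits (n : nat) : word :=
  mkseq (fun i => odd (n %/ 2 ^ i)) (trunc_log 2 n).+1.

Definition enc_nat (u : weight_coding) (n : nat) : word :=
  match u with
  | Unary => rcons (nseq n true) false
  | Binary => enc_word (bits n)
  end.

Definition enc_weight (u : weight_coding) (w : weight) : word :=
  if w is Some n then true :: enc_nat u n else [:: false].

Fixpoint enc_concept (C : concept) : word :=
  match C with
  | CName A => [:: false; false] ++ enc_word A
  | CTop => [:: false; true; false]
  | CBot => [:: false; true; true]
  | CAnd C1 C2 => [:: true; false] ++ enc_concept C1 ++ enc_concept C2
  | CEx R C1 => [:: true; true] ++ enc_word R ++ enc_concept C1
  end.

Definition enc_inclusion (t : inclusion) : word :=
  enc_concept t.1 ++ enc_concept t.2.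

Definition enc_assertion (a : assertion) : word :=
  match a with
  | AConcept A a => false :: enc_word A ++ enc_word a
  | ARole R a b => true :: enc_word R ++ enc_word a ++ enc_word b
  end.

Definition enc_wkb (u : weight_coding) (K : wkb) : word :=
  enc_seq (fun p => enc_inclusion p.1 ++ enc_weight u p.2) (tbox K) ++
  enc_seq (fun p => enc_assertion p.1 ++ enc_weight u p.2) (abox K).

Definition enc_term (t : term) : word :=
  match t with
  | TVar x => false :: enc_word x
  | TInd a => true :: enc_word a
  end.

Definition enc_query (q : iquery) : word :=
  match q with
  | QConcept A t => false :: enc_word A ++ enc_term t
  | QRole R t u => true :: enc_word R ++ enc_term t ++ enc_term u
  end.

Definition enc_instance (u : weight_coding) (K : wkb) (q : iquery) : word :=
  enc_wkb u K ++ enc_query q.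

(* Words that encode no instance are no-instances. *)
Definition iq_possible (u : weight_coding) : language :=
  [set w | exists K q, [/\ wf_wkb K, w = enc_instance u K q
                          & entails_possible K q]].

Definition iq_certain (u : weight_coding) : language :=
  [set w | exists K q, [/\ wf_wkb K, w = enc_instance u K q
                          & entails_certain K q]].

(** * Unique readability of instances *)

Definition prefix_inj (T : Type) (e : T -> word) :=
  forall x y s t, e x ++ s = e y ++ t -> x = y /\ s = t.

Lemma enc_word_inj : prefix_inj enc_word.
Proof.
elim=> [|a x IH] [|b y] s t //=; first by case.
by case=> -> /IH[-> ->].
Qed.

Lemma enc_word_catA w s t : (enc_word w ++ s) ++ t = enc_word w ++ s ++ t.
Proof. by rewrite catA. Qed.

Lemma enc_seq_inj (T : Type) (e : T -> word) :
  prefix_inj e -> prefix_inj (enc_seq e).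
Proof.
move=> ei; rewrite /enc_seq; elim=> [|a x IH] [|b y] s t //=; first by case.
by case; rewrite -!(catA (e _)) => /ei[-> /IH[-> ->]].
Qed.

Lemma bits_inj : injective bits.
Proof.
have half_digit n i : odd (n %/ 2 ^ i.+1) = odd (n./2 %/ 2 ^ i).
  by rewrite expnS divnMA divn2.
have digits n : forall m, (forall i, odd (m %/ 2 ^ i) = odd (n %/ 2 ^ i)) -> m = n.
  elim/ltn_ind: n => n IH m mn.
  have mn0 : odd m = odd n by have := mn 0; rewrite !divn1.
  have mnS i : odd (m./2 %/ 2 ^ i) = odd (n./2 %/ 2 ^ i).
    by rewrite -!half_digit.
  case: n => [|n] in IH mn mn0 mnS *; last first.
    rewrite -[m]odd_double_half -[n.+1 in RHS]odd_double_half mn0.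
    by rewrite (IH _ _ _ mnS)// -divn2 ltn_Pdiv.
  apply/eqP; rewrite -leqn0 leqNgt; apply/negP => m_gt0.
  have := mn (trunc_log 2 m); rewrite div0n /=.
  have /andP[lo hi] := trunc_log_bounds (isT : 1 < 2) m_gt0.
  suff -> : m %/ 2 ^ trunc_log 2 m = 1 by [].
  apply/eqP; rewrite eqn_leq -ltnS ltn_divLR ?expn_gt0// -expnS hi /=.
  by rewrite divn_gt0 ?expn_gt0.
move=> m n mn; apply: digits => i.
have digit p : odd (p %/ 2 ^ i) = nth false (bits p) i.
  have [ip|pi] := ltnP i (trunc_log 2 p).+1; first by rewrite nth_mkseq.
  rewrite nth_default ?size_mkseq// divn_small//.
  case: p pi => [|p] pi; first by rewrite expn_gt0.
  have /andP[_ /leq_trans->//] := trunc_log_bounds (isT : 1 < 2) (ltn0Sn p).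
  by rewrite leq_exp2l.
by rewrite !digit mn.
Qed.

Lemma enc_weight_inj u : prefix_inj (enc_weight u).
Proof.
have natI : prefix_inj (enc_nat u).
  case: u => m n s t; rewrite /enc_nat; last by move/enc_word_inj => [/bits_inj -> ->].
  rewrite !cat_rcons; elim: m n => [|m IH] [|n] //=; first by case.
  by case=> /IH[-> ->].
by move=> [m|] [n|] s t //= [] => [/natI[-> ->]|->].
Qed.

Lemma enc_concept_inj : prefix_inj enc_concept.
Proof.
elim=> [A|||C IHC D IHD|R C IHC] [B|||C' D'|R' C'] s t //=.
- by case=> /enc_word_inj[-> ->].
- by case.
- by case.
- by rewrite -!catA => -[/IHC[-> /IHD[-> ->]]].
- by rewrite !enc_word_catA => -[/enc_word_inj[-> /IHC[-> ->]]].
Qed.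

Lemma enc_inclusion_inj : prefix_inj enc_inclusion.
Proof.
move=> [C D] [C' D'] s t; rewrite /enc_inclusion -!catA /=.
by case/enc_concept_inj => -> /enc_concept_inj[-> ->].
Qed.

Lemma enc_assertion_inj : prefix_inj enc_assertion.
Proof.
move=> [A a|R a b] [A' a'|R' a' b'] s t //=; rewrite !enc_word_catA => -[].
  by case/enc_word_inj => -> /enc_word_inj[-> ->].
by case/enc_word_inj => -> /enc_word_inj[-> /enc_word_inj[-> ->]].
Qed.

Lemma enc_term_inj : prefix_inj enc_term.
Proof. by move=> [x|x] [y|y] s t //= [] /enc_word_inj[-> ->]. Qed.

Lemma enc_query_inj : prefix_inj enc_query.
Proof.
move=> [A t|R t u] [A' t'|R' t' u'] s s' //=; rewrite !enc_word_catA => -[].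
  by case/enc_word_inj => -> /enc_term_inj[-> ->].
by case/enc_word_inj => ->; rewrite -!catA => /enc_term_inj[-> /enc_term_inj[-> ->]].
Qed.

Lemma enc_instance_inj u K q K' q' :
  enc_instance u K q = enc_instance u K' q' -> K = K' /\ q = q'.
Proof.
have axI T (e : T -> word) : prefix_inj e ->
    prefix_inj (fun p : T * weight => e p.1 ++ enc_weight u p.2).
  move=> ei [x w] [y v] s t /=; rewrite -!catA.
  by case/ei => -> /enc_weight_inj[-> ->].
case: K K' => [T A] [T' A']; rewrite /enc_instance /enc_wkb.
rewrite -!(catA (enc_seq _ _) (enc_seq _ _)) /tbox /abox.
case/(enc_seq_inj (axI _ _ enc_inclusion_inj)) => ->.
case/(enc_seq_inj (axI _ _ enc_assertion_inj)) => ->.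
by rewrite -[LHS]cats0 -[RHS]cats0 => /enc_query_inj[-> _].
Qed.

(* Main.v *)
(* An inclusion of Bool in bottom of weight 1 and the strict assertions Bool(true),
   Bool(false), True(true), False(false) make 2 the optimal cost: it is reached
   exactly by the models of the strict axioms in which Bool is {true, false}.
   Hence an R-successor in Bool is a guessed bit, and strict inclusions
   in bottom relate the bits of a node to those of its successors, so that
   polynomially many inclusions implement binary counters with m bits.

   A node carries a time t and, for each tape, the position of a cell relative
   to the head; its label is the state at time t and the contents of these
   cells.  The label at time t + 1 is a function of two labels at time t: that
   of the scanned cells, which determines the transition, and that of the same
   cells, whose positions are shifted by the moves of the heads.  Therefore the
   labels are derived by Horn inclusions from the initial ones, and uniqueness
   of the run makes every optimal model agree on whether the individual standing
   for the scanned cells at time 2 ^ m - 1 is accepting.  This answers the query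
   both in the certain and in the possible sense.  As counters are taken modulo
   2 ^ m, the tapes are circular, which is harmless when 2 ^ m exceeds the
   running time plus the length of the input.

   The knowledge base is written by a while-program over tapes, whose running
   time is polynomial. *)
From mathcomp Require Import all_boot all_order all_algebra.
From mathcomp Require Import mathcomp_extra boolp classical_sets functions.
From mathcomp Require Import cardinality constructive_ereal zify.
Require Import Defs.

Set Implicit Arguments.
Unset Strict Implicit.
Unset Printing Implicit Defensive.

(** * While-programs over tapes and the machines that run them *)

Definition upd (I : eqType) (T : Type) (f : I -> T) (i : I) (x : T) : I -> T :=
  fun j => if j == i then x else f j.

Lemma upd_same (I : eqType) T (f : I -> T) i x : upd f i x i = x.
Proof. by rewrite /upd eqxx. Qed.

Lemma upd_upd (I : eqType) T (f : I -> T) i x y : upd (upd f i x) i y = upd f i y.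
Proof. by apply/funext => j; rewrite /upd; case: eqP. Qed.

Section Programs.
Variables (e : nat) (G : finType).
Local Notation index := 'I_e.+1.
Local Notation tapes := (index -> tape G).

Inductive prog :=
| Act of index & (symbol G -> symbol G) & direction
| Seq of prog & prog
| If of index & pred (symbol G) & prog & prog
| While of index & pred (symbol G) & prog.

(** The additional state [None] of a conditional or a loop is the one in which its test is made. *)
Fixpoint pstate (p : prog) : finType :=
  match p with
  | Act _ _ _ => unit
  | Seq p q => (pstate p + pstate q)%type
  | If _ _ p q => option (pstate p + pstate q)
  | While _ _ p => option (pstate p)
  end.

Fixpoint pstart (p : prog) : pstate p :=
  match p with
  | Act _ _ _ => tt
  | Seq p q => inl (pstart p)
  | If _ _ _ _ => None
  | While _ _ _ => None
  end.

Definition action : Type := option (index * symbol G * direction).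

Fixpoint pstep (p : prog) :
    pstate p -> (index -> symbol G) -> option (pstate p) * action :=
  match p with
  | Act i f d => fun _ r => (None, Some (i, f (r i), d))
  | Seq p q => fun s r =>
      match s with
      | inl s => let: (s', a) := pstep s r in
          (Some (if s' is Some s' then inl s' else inr (pstart q)), a)
      | inr s => let: (s', a) := pstep s r in (omap inr s', a)
      end
  | If i b p q => fun s r =>
      match s with
      | None => (Some (Some (if b (r i) then inl (pstart p) else inr (pstart q))), None)
      | Some (inl s) => let: (s', a) := pstep s r in (omap (Some \o inl) s', a)
      | Some (inr s) => let: (s', a) := pstep s r in (omap (Some \o inr) s', a)
      end
  | While i b p => fun s r =>
      match s with
      | None => (if b (r i) then Some (Some (pstart p)) else None, None)
      | Some s => let: (s', a) := pstep s r in (Some s', a)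
      end
  end.

Definition perform (a : action) (t : tapes) : tapes :=
  if a is Some (i, s, d) then upd t i (tape_move d (tape_write s (t i))) else t.

Definition mstep (p : prog) (c : option (pstate p) * tapes) :=
  if c.1 is Some s then
    let: (s', a) := pstep s (fun i => thead (c.2 i)) in (s', perform a c.2)
  else c.

(* [mstep] fixes the configurations whose control has exited, so that [n] is
   only an upper bound on the number of steps. *)
Definition runs p (s : pstate p) (t t' : tapes) (n : nat) : Prop :=
  iter n (@mstep p) (Some s, t) = (None, t').

Lemma iter_mstep_None p n t : iter n (@mstep p) (None, t) = (None, t).
Proof. by elim: n => //= n ->. Qed.

Lemma runs_le p (s : pstate p) t t' n n' : n <= n' -> runs s t t' n -> runs s t t' n'.
Proof. by move=> /subnK <-; rewrite /runs iterD => ->; rewrite iter_mstep_None. Qed.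

Lemma runsS p (s : pstate p) t t' n :
  runs s t t' n.+1 <->
  let: (s', a) := pstep s (fun i => thead (t i)) in
  if s' is Some s' then runs s' (perform a t) t' n else t' = perform a t.
Proof.
rewrite /runs iterSr /mstep /=; case: pstep => [[s'|] a] //.
by rewrite iter_mstep_None; split=> [[->]|->].
Qed.

(** The last step of [p] already enters [pstart q], so sequencing costs no step of its own. *)
Lemma runs_seq p q (s : pstate p) t t' t'' n n' :
  runs s t t' n -> runs (pstart q) t' t'' n' ->
  runs (p := Seq p q) (inl s) t t'' (n + n').
Proof.
elim: n => [|n IH] in s t *; first by [].
rewrite addSn => /runsS/=; rewrite runsS /=.
case: pstep => [[s'|] a]; first exact: IH.
move=> -> {IH} H; apply: (@runs_le _ _ _ _ n'); first exact: leq_addl.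
elim: n' (pstart q) (perform a t) H => [|m IH] s' u; first by [].
move/runsS; rewrite runsS /=; case: pstep => [[s''|] a'] //=; exact: IH.
Qed.

Lemma runs_ifl i b p q (s : pstate p) t t' n :
  runs s t t' n -> runs (p := If i b p q) (Some (inl s)) t t' n.
Proof.
elim: n => [|n IH] in s t *; first by [].
by move/runsS; rewrite runsS /=; case: pstep => [[s'|] a] //=; exact: IH.
Qed.

Lemma runs_ifr i b p q (s : pstate q) t t' n :
  runs s t t' n -> runs (p := If i b p q) (Some (inr s)) t t' n.
Proof.
elim: n => [|n IH] in s t *; first by [].
by move/runsS; rewrite runsS /=; case: pstep => [[s'|] a] //=; exact: IH.
Qed.

Lemma runs_while i b p (s : pstate p) t t' t'' n n' :
  runs s t t' n -> runs (p := While i b p) None t' t'' n' ->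
  runs (p := While i b p) (Some s) t t'' (n + n').
Proof.
elim: n => [|n IH] in s t *; first by [].
rewrite addSn => /runsS/=; rewrite runsS /=.
case: pstep => [[s'|] a]; first exact: IH.
by move=> -> H; apply: runs_le H; exact: leq_addl.
Qed.

(** A step moves each head by at most one cell. This later bounds the length of the output by the
    time spent on writing it. *)
Lemma size_tleft_runs p (s : pstate p) t t' n i :
  runs s t t' n -> size (tleft (t' i)) <= size (tleft (t i)) + n.
Proof.
have le a u : size (tleft (perform a u i)) <= (size (tleft (u i))).+1.
  case: a => [[[j x] d]|] //=; rewrite /upd; case: eqP => // ->.
  by case: d => /=; rewrite ?size_behead; lia.
elim: n => [|n IH] in s t *; first by [].
move/runsS; case: pstep => [[s'|] a] => [/IH|->].
  by move/leq_trans; apply; rewrite addnS -addSn leq_add2r le.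
by apply: leq_trans (le a t) _; rewrite addnS ltnS leq_addr.
Qed.

Definition machine_of (p : prog) : turing_machine :=
  @TuringMachine e (option (pstate p)) G (Some (pstart p))
    (fun q => q == None) pred0
    (fun q r =>
       if q is Some s then
         let: (s', a) := pstep s r in
         (s', [ffun j => if a is Some (i, x, d) then
                           if j == i then (x, d) else (r j, Stay)
                         else (r j, Stay)])
       else (None, [ffun j => (r j, Stay)])).

Lemma tm_step_machine_of p s t :
  tm_step (@Config (machine_of p) s t) =
  @Config (machine_of p) (@mstep p (s, t)).1 (@mstep p (s, t)).2.
Proof.
case: s => [s|] //=; rewrite /mstep /tm_step /=.
have -> : [ffun i => thead (t i)] = (fun i => thead (t i)) :> (_ -> _).
  by apply/funext => i; rewrite ffunE.
have st (u : tape G) : tape_write (thead u) u = u by case: u.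
case: pstep => [s' [[[i x] d]|]] /=; congr Config; apply/funext => j;
  rewrite !ffunE /upd; last by rewrite /= ?ffunE st.
by case: eqP => [->|_] //=; rewrite ?ffunE st.
Qed.

Lemma machine_ofP p t n w :
  runs (pstart p) (cf_tapes (tm_init (machine_of p) w)) t n ->
  let c := tm_run (machine_of p) n w in
  tm_halt (cf_state c) /\ cf_tapes c = t.
Proof.
rewrite /runs /tm_run => H.
suff E m : let c := iter m (@mstep p)
      (Some (pstart p), cf_tapes (tm_init (machine_of p) w)) in
    iter m (@tm_step (machine_of p)) (tm_init (machine_of p) w) =
    @Config (machine_of p) c.1 c.2.
  by have /= := E n; rewrite H => ->.
elim: m => [|m /=] //= ->; rewrite tm_step_machine_of.
by rewrite -surjective_pairing.
Qed.

(** * Tape contents *)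

(* [Parked s]: the tape contains [s] and the head scans the blank before it.
   [Scan u v]: the tape contains [u ++ v] and the head scans the first cell
   of [v], or the blank behind [u] if [v] is empty. *)
Inductive content := Parked of word | Scan of word & word.

Definition cells (s : word) : seq (symbol G) := [seq Some (inl b) | b <- s].

(* Explicit blanks pile up behind the contents as the head visits them. *)
Definition holds (c : content) (t : tape G) : Prop :=
  match c with
  | Parked s => exists j, t = Tape [::] None (cells s ++ nseq j None)
  | Scan u v => exists j, t = Tape (rev (cells u) ++ [:: None])
      (head None (cells v ++ nseq j None)) (behead (cells v ++ nseq j None))
  end.

Local Notation state := (index -> content).

(** Specifications leave the number of trailing blanks open, so that they compose whatever blanks
    the heads have visited. *)
Definition exec (p : prog) (S S' : state) (n : nat) : Prop :=
  forall t, (forall i, holds (S i) (t i)) ->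
  exists2 t', (forall i, holds (S' i) (t' i)) & runs (pstart p) t t' n.

Lemma exec_le p S S' n n' : n <= n' -> exec p S S' n -> exec p S S' n'.
Proof.
by move=> le H t /H[t' ? r]; exists t' => //; exact: runs_le r.
Qed.

Lemma exec_seq p q S S' S'' n n' :
  exec p S S' n -> exec q S' S'' n' -> exec (Seq p q) S S'' (n + n').
Proof.
move=> Hp Hq t /Hp[t' /Hq[t'' h r'] r]; exists t'' => //; exact: runs_seq r r'.
Qed.

Lemma exec_act i f d S c c' : S i = c ->
  (forall t, holds c t -> holds c' (tape_move d (tape_write (f (thead t)) t))) ->
  exec (Act i f d) S (upd S i c') 1.
Proof.
move=> <- H t h; exists (upd t i (tape_move d (tape_write (f (thead (t i))) (t i)))).
  by move=> j; rewrite /upd; case: eqP => [_|_]; [exact: H | exact: h].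
by rewrite /runs.
Qed.

Definition nonblank (s : symbol G) : bool := s != None.

Definition at_end (c : content) := if c is Scan _ (_ :: _) then false else true.

Lemma holds_nonblank c t : holds c t -> nonblank (thead t) = ~~ at_end c.
Proof.
case: c => [s|u [|b v]] /= [j ->] //=; by case: j.
Qed.

Lemma exec_while_end i p S : at_end (S i) -> exec (While i nonblank p) S S 1.
Proof.
move=> H t h; exists t => //; apply/runsS => /=.
by rewrite (holds_nonblank (h i)) H.
Qed.

Lemma exec_while i p S S' S'' n n' :
  ~~ at_end (S i) -> exec p S S' n -> exec (While i nonblank p) S' S'' n' ->
  exec (While i nonblank p) S S'' (n + n').+1.
Proof.
move=> H Hp Hw t h; have [t' /Hw[t'' h'' rw] rp] := Hp t h; exists t'' => //.
by apply/runsS => /=; rewrite (holds_nonblank (h i)) H; exact: runs_while rp rw.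
Qed.

Definition reads_true (s : symbol G) : bool := if s is Some (inl b) then b else false.

Lemma exec_if i p q S S' n u b v :
  S i = Scan u (b :: v) -> exec (if b then p else q) S S' n ->
  exec (If i reads_true p q) S S' n.+1.
Proof.
move=> Si H t h; have [t' h' r] := H t h; exists t' => //.
apply/runsS => /=; have := h i; rewrite Si => -[j ->] /=.
by case: b {Si} H r => _; [exact: runs_ifl | exact: runs_ifr].
Qed.

Lemma holds_parked_right s t : holds (Parked s) t -> holds (Scan [::] s) (tape_move GoRight t).
Proof. by case=> j -> /=; exists j. Qed.

Lemma holds_scan_right u b v t :
  holds (Scan u (b :: v)) t -> holds (Scan (rcons u b) v) (tape_move GoRight t).
Proof.
by case=> j -> /=; exists j; rewrite /cells map_rcons rev_rcons.
Qed.

Lemma holds_scan0_left v t : holds (Scan [::] v) t -> holds (Parked v) (tape_move GoLeft t).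
Proof.
case=> j -> /=; case: v => [|b v] /=; last by exists j.
(* Without explicit blanks the head scans an implicit one, which its departure makes explicit. *)
by case: j => [|j]; [exists 1 | exists j.+1].
Qed.

Lemma holds_scan_left u b v t :
  holds (Scan (rcons u b) v) t -> holds (Scan u (b :: v)) (tape_move GoLeft t).
Proof.
case=> j -> /=; rewrite /cells map_rcons rev_rcons /=.
case: v => [|c v] /=; last by exists j.
by case: j => [|j]; [exists 1 | exists j.+1].
Qed.

(** The written cell uses up one of the explicit trailing blanks if there is any, hence the witness
    [j.-1]. *)
Lemma holds_write u b t :
  holds (Scan u [::]) t -> holds (Scan u [:: b]) (tape_write (Some (inl b)) t).
Proof. by case=> j ->; exists j.-1; case: j. Qed.

Lemma holds_erase u b t :
  holds (Scan u [:: b]) t -> holds (Scan u [::]) (tape_write None t).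
Proof. by case=> j ->; exists j.+1. Qed.

Lemma tape_write_thead (t : tape G) : tape_write (thead t) t = t.
Proof. by case: t. Qed.

(** * Basic programs and loops over the letters of a tape *)

Definition move i d := Act i id d.

(** The first move leaves the blank behind the contents, on which the loop would stop at once. *)
Definition rewind i := Seq (move i GoLeft) (While i nonblank (move i GoLeft)).

Definition to_end i := Seq (move i GoRight) (While i nonblank (move i GoRight)).

Lemma exec_move i d S c c' : S i = c ->
  (forall t, holds c t -> holds c' (tape_move d t)) ->
  exec (move i d) S (upd S i c') 1.
Proof.
by move=> Si H; apply: exec_act Si _ => t /H; rewrite tape_write_thead.
Qed.

Lemma exec_left_loop i S u b v : S i = Scan u (b :: v) ->
  exec (While i nonblank (move i GoLeft)) S (upd S i (Parked (u ++ b :: v)))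
    (2 * size u + 3).
Proof.
elim/last_ind: u => [|u c IH] in S b v *; move=> Si.
  apply: (exec_while (n := 1) (n' := 1) (S' := upd S i (Parked (b :: v)))).
  - by rewrite Si.
  - by apply: exec_move Si _; exact: holds_scan0_left.
  - by apply: exec_while_end; rewrite upd_same.
have := IH (upd S i (Scan u (c :: b :: v))) c (b :: v) (upd_same _ _ _).
rewrite upd_upd cat_rcons => H; apply: exec_le (exec_while (n := 1) _ _ H).
- by rewrite size_rcons; lia.
- by rewrite Si.
- by apply: exec_move Si _; exact: holds_scan_left.
Qed.

Lemma exec_rewind i S u v : S i = Scan u v ->
  exec (rewind i) S (upd S i (Parked (u ++ v))) (2 * size u + 2).
Proof.
case/lastP: u => [|u b] Si.
  apply: (exec_seq (n := 1) (n' := 1) (S' := upd S i (Parked v))).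
    by apply: exec_move Si _; exact: holds_scan0_left.
  by apply: exec_while_end; rewrite upd_same.
have := exec_left_loop (upd_same S i (Scan u (b :: v))).
rewrite upd_upd cat_rcons => H; apply: exec_le (exec_seq (n := 1) _ H).
  by rewrite size_rcons; lia.
by apply: exec_move Si _; exact: holds_scan_left.
Qed.

Lemma exec_right_loop i S u v : S i = Scan u v ->
  exec (While i nonblank (move i GoRight)) S (upd S i (Scan (u ++ v) [::]))
    (2 * size v + 1).
Proof.
elim: v => [|b v IH] in S u *; move=> Si.
  have -> : upd S i (Scan (u ++ [::]) [::]) = S.
    by apply/funext => j; rewrite /upd cats0; case: eqP => // ->.
  by apply: exec_while_end; rewrite Si.
have := IH (upd S i (Scan (rcons u b) v)) _ (upd_same _ _ _).
rewrite upd_upd cat_rcons => H; apply: exec_le (exec_while (n := 1) _ _ H).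
- by rewrite /=; lia.
- by rewrite Si.
- by apply: exec_move Si _; exact: holds_scan_right.
Qed.

Lemma exec_to_end i S s : S i = Parked s ->
  exec (to_end i) S (upd S i (Scan s [::])) (2 * size s + 2).
Proof.
move=> Si; have := exec_right_loop (upd_same S i (Scan [::] s)).
rewrite upd_upd => H; apply: exec_le (exec_seq (n := 1) _ H); first by lia.
by apply: exec_move Si _; exact: holds_parked_right.
Qed.

Definition append i b :=
  Seq (to_end i) (Seq (Act i (fun=> Some (inl b)) Stay) (rewind i)).

Lemma exec_append i b S s : S i = Parked s ->
  exec (append i b) S (upd S i (Parked (rcons s b))) (4 * size s + 10).
Proof.
move=> Si; have H1 := exec_to_end Si.
have H2 := exec_act (f := fun=> Some (inl b)) (d := Stay) (upd_same S i (Scan s [::])) (@holds_write s b).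
have := exec_rewind (upd_same S i (Scan s [:: b])).
rewrite !upd_upd in H2 * => H3; rewrite -cats1.
by apply: exec_le (exec_seq H1 (exec_seq H2 H3)); lia.
Qed.

(** The head stays behind the contents, so that the running time, unlike that of [append], does not
    depend on what has been written before. *)
Fixpoint emit i (w : word) : prog :=
  if w is b :: w' then Seq (Act i (fun=> Some (inl b)) GoRight) (emit i w')
  else move i Stay.

Lemma holds_emit b u t :
  holds (Scan u [::]) t ->
  holds (Scan (rcons u b) [::]) (tape_move GoRight (tape_write (Some (inl b)) t)).
Proof. by move/(holds_write b)/holds_scan_right. Qed.

Lemma exec_emit i w S u : S i = Scan u [::] ->
  exec (emit i w) S (upd S i (Scan (u ++ w) [::])) (size w).+1.
Proof.
elim: w => [|b w IH] in S u *; move=> Si.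
  by apply: exec_move Si _; rewrite cats0.
have := exec_act (f := fun=> Some (inl b)) (d := GoRight) Si (@holds_emit b u).
have := IH (upd S i (Scan (rcons u b) [::])) _ (upd_same _ _ _).
by rewrite upd_upd cat_rcons => H2 H1; exact: exec_seq H1 H2.
Qed.

Definition clear i :=
  Seq (to_end i) (Seq (move i GoLeft)
    (While i nonblank (Act i (fun=> None) GoLeft))).

Lemma holds_erase_left u b c t :
  holds (Scan (rcons u b) [:: c]) t ->
  holds (Scan u [:: b]) (tape_move GoLeft (tape_write None t)).
Proof. by move/holds_erase/holds_scan_left. Qed.

Lemma holds_erase0_left c t :
  holds (Scan [::] [:: c]) t ->
  holds (Parked [::]) (tape_move GoLeft (tape_write None t)).
Proof. by move/holds_erase/holds_scan0_left. Qed.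

Lemma exec_clear_loop i S u b : S i = Scan u [:: b] ->
  exec (While i nonblank (Act i (fun=> None) GoLeft)) S
    (upd S i (Parked [::])) (2 * size u + 3).
Proof.
elim/last_ind: u => [|u c IH] in S b *; move=> Si.
  apply: (exec_while (n := 1) (n' := 1) (S' := upd S i (Parked [::]))).
  - by rewrite Si.
  - by apply: exec_act Si _; exact: holds_erase0_left.
  - by apply: exec_while_end; rewrite upd_same.
have := IH (upd S i (Scan u [:: c])) c (upd_same _ _ _).
rewrite upd_upd => H; apply: exec_le (exec_while (n := 1) _ _ H).
- by rewrite size_rcons; lia.
- by rewrite Si.
- by apply: exec_act Si _; exact: holds_erase_left.
Qed.

Lemma exec_clear i S s : S i = Parked s ->
  exec (clear i) S (upd S i (Parked [::])) (4 * size s + 10).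
Proof.
case/lastP: s => [|s b] Si; have H1 := exec_to_end Si.
  have := exec_move (upd_same S i (Scan [::] [::])) (@holds_scan0_left [::]).
  have := @exec_while_end i (Act i (fun=> None) GoLeft) (upd S i (Parked [::])).
  rewrite upd_same upd_upd => /(_ isT) H3 H2.
  by apply: exec_le (exec_seq H1 (exec_seq H2 H3)).
have H2 := exec_move (upd_same S i (Scan (rcons s b) [::])) (@holds_scan_left s b [::]).
have := exec_clear_loop (upd_same S i (Scan s [:: b])).
rewrite !upd_upd in H2 * => H3.
by apply: exec_le (exec_seq H1 (exec_seq H2 H3)); rewrite size_rcons; lia.
Qed.

(* The body must leave the head of tape [i] where it found it. *)
Definition for_each i (body : bool -> prog) :=
  Seq (move i GoRight)
    (Seq (While i nonblank
           (Seq (If i reads_true (body true) (body false)) (move i GoRight)))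
         (rewind i)).

(** The invariant rule: [F u] is the state once the prefix [u] has been processed, up to tape [i],
    which shows the position of the scan. *)
Lemma exec_for_loop i body (F : word -> state) n u v :
  (forall u' b v', u ++ v = u' ++ b :: v' ->
     exec (body b) (upd (F u') i (Scan u' (b :: v')))
       (upd (F (rcons u' b)) i (Scan u' (b :: v'))) n) ->
  exec (While i nonblank
         (Seq (If i reads_true (body true) (body false)) (move i GoRight)))
    (upd (F u) i (Scan u v)) (upd (F (u ++ v)) i (Scan (u ++ v) [::]))
    (size v * (n + 3) + 1).
Proof.
elim: v => [|b v IH] in u * => H.
  by rewrite cats0; apply: exec_while_end; rewrite upd_same.
have := IH (rcons u b); rewrite cat_rcons => /(_ H) {}IH.
have Hb : exec (If i reads_true (body true) (body false))
    (upd (F u) i (Scan u (b :: v))) (upd (F (rcons u b)) i (Scan u (b :: v))) n.+1.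
  by apply: (exec_if (upd_same _ _ _)); have := H u b v erefl; case: (b).
have := exec_move (upd_same (F (rcons u b)) i (Scan u (b :: v)))
          (@holds_scan_right u b v).
rewrite upd_upd => Hm.
apply: exec_le (exec_while _ (exec_seq Hb Hm) IH); first by rewrite /= mulSn; lia.
by rewrite upd_same.
Qed.

Lemma exec_for i body (F : word -> state) n s :
  (forall u b v, s = u ++ b :: v ->
     exec (body b) (upd (F u) i (Scan u (b :: v)))
       (upd (F (rcons u b)) i (Scan u (b :: v))) n) ->
  exec (for_each i body) (upd (F [::]) i (Parked s)) (upd (F s) i (Parked s))
    (size s * (n + 5) + 4).
Proof.
move=> H.
have := exec_move (upd_same (F [::]) i (Parked s)) (@holds_parked_right s).
rewrite upd_upd => H1; have H2 := @exec_for_loop i body F n [::] s H.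
have := exec_rewind (upd_same (F s) i (Scan s [::])).
rewrite upd_upd cats0 => H3.
apply: exec_le (exec_seq H1 (exec_seq H2 H3)).
by rewrite !mulnDr; lia.
Qed.

Lemma upd_comm (S : state) i k c c' : i != k ->
  upd (upd S i c) k c' = upd (upd S k c') i c.
Proof.
move=> ik; apply/funext => j; rewrite /upd.
by case: eqP => // ->; rewrite eq_sym (negbTE ik).
Qed.

Lemma upd_id (S : state) i c : S i = c -> upd S i c = S.
Proof. by move=> <-; apply/funext => j; rewrite /upd; case: eqP => // ->. Qed.

Lemma exec_add_size i k S s x : i != k -> S i = Parked s ->
  S k = Parked (nseq x true) ->
  exec (for_each i (fun=> append k true)) S
    (upd S k (Parked (nseq (x + size s) true)))
    (size s * (4 * (x + size s) + 15) + 4).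
Proof.
move=> ik Si Sk; pose F u := upd S k (Parked (nseq (x + size (u : word)) true)).
have H u b v : s = u ++ b :: v ->
    exec (append k true) (upd (F u) i (Scan u (b :: v)))
      (upd (F (rcons u b)) i (Scan u (b :: v))) (4 * (x + size s) + 10).
  move=> sE.
  have Fk : upd (F u) i (Scan u (b :: v)) k = Parked (nseq (x + size u) true).
    by rewrite /F /upd eq_sym (negbTE ik) eqxx.
  have := exec_append true Fk.
  have -> : rcons (nseq (x + size u) true) true = nseq (x + size (rcons u b)) true.
    by rewrite -cats1 -(nseqD _ 1) size_rcons addn1 addnS.
  rewrite upd_comm // upd_upd.
  by apply: exec_le; rewrite size_nseq sE size_cat; lia.
have := exec_for H.
have -> : F [::] = S by rewrite /F addn0 upd_id.
rewrite (upd_id Si) [upd (F s) _ _]upd_id; last by rewrite /F /upd (negbTE ik).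
by apply: exec_le; rewrite -addnA.
Qed.

End Programs.

(** * Indexed inclusions *)

Inductive subscript := Zero | Here | Next.

Definition subscript_val (x : subscript) (i : nat) : nat :=
  match x with Zero => 0 | Here => i | Next => i.+1 end.

(** Base and subscript are in unary, so that a program emits the subscript by running over its index
    tape; the first [false] separates them. *)
Definition name (k x : nat) : word := nseq k true ++ false :: nseq x true.

Arguments name : simpl never.

Lemma name_inj k x k' x' : name k x = name k' x' -> k = k' /\ x = x'.
Proof.
elim: k k' => [|k IH] [|k'] //= [].
  by move/(congr1 size); rewrite !size_nseq.
by case/IH => -> ->.
Qed.

(* Concepts depending on a parameter [i : nat], which is the subscript of the
   names marked [Here]; it is the successor of the subscript of those marked
   [Next]. *)
Inductive template :=
| TName of nat & subscript
| TTop
| TBot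
| TAnd of template & template
| TEx of nat & subscript & template.

Fixpoint inst (i : nat) (C : template) : concept :=
  match C with
  | TName k x => CName (name k (subscript_val x i))
  | TTop => CTop
  | TBot => CBot
  | TAnd C D => CAnd (inst i C) (inst i D)
  | TEx k x C => CEx (name k (subscript_val x i)) (inst i C)
  end.

Definition top_pile n : concept := iter n (CAnd CTop) CTop.

(* The conjuncts equivalent to [CTop] make the inclusions pairwise distinct. *)
Fixpoint label_rules (i s j : nat) (L : seq (template * template)) : seq inclusion :=
  if L is (C, D) :: L' then
    (CAnd (top_pile i) (CAnd (top_pile s) (CAnd (top_pile j) (inst i C))), inst i D)
    :: label_rules i s j.+1 L'
  else [::].

(** The lists are fixed once the machine is. Only their instances depend on the input: at each digit
    position, at the number of digits, at each letter position, and at the length of the word. *)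
Record rule_family := RuleFamily {
  loop_rules : seq (template * template);
  bound_rules : seq (template * template);
  letter_rules : bool -> seq (template * template);
  length_rules : seq (template * template) }.

Definition family_loop (F : rule_family) m : seq inclusion :=
  flatten [seq label_rules i 0 0 (loop_rules F) | i <- iota 0 m].

Definition family_letters (F : rule_family) (w : word) n : seq inclusion :=
  flatten [seq label_rules p 2 0 (letter_rules F (nth false w p)) | p <- iota 0 n].

Definition family_inclusions (F : rule_family) m (w : word) : seq inclusion :=
  (family_loop F m ++ label_rules m 1 0 (bound_rules F)) ++
  (family_letters F w (size w) ++ label_rules (size w) 3 0 (length_rules F)).

Definition family_wkb (F : rule_family) soft ab m (w : word) : wkb :=
  WKB (soft :: [seq (x, None) | x <- family_inclusions F m w]) ab.

(** * Polynomial running times *)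

(** The base [n.+1] is positive, so that the bound grows with the exponent even at [n = 0]. *)
Definition polyb (T : nat -> nat) : Prop :=
  exists c d, forall n, T n <= c * n.+1 ^ d.

Lemma polyb_le T T' : (forall n, T n <= T' n) -> polyb T' -> polyb T.
Proof. by move=> le [c [d H]]; exists c, d => n; exact: leq_trans (le n) (H n). Qed.


Lemma polyb_const k : polyb (fun=> k).
Proof. by exists k, 0 => n; rewrite expn0 muln1. Qed.

Lemma polyb_id : polyb id.
Proof. by exists 1, 1 => n; rewrite mul1n expn1. Qed.

Lemma polyb_add T T' : polyb T -> polyb T' -> polyb (fun n => T n + T' n).
Proof.
move=> [c [d H]] [c' [d' H']]; exists (c + c'), (d + d') => n.
rewrite mulnDl; apply: leq_add.
  by apply: leq_trans (H n) _; rewrite leq_mul2l leq_pexp2l ?orbT ?leq_addr.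
by apply: leq_trans (H' n) _; rewrite leq_mul2l leq_pexp2l ?orbT ?leq_addl.
Qed.

Lemma polyb_mul T T' : polyb T -> polyb T' -> polyb (fun n => T n * T' n).
Proof.
move=> [c [d H]] [c' [d' H']]; exists (c * c'), (d + d') => n.
by rewrite expnD mulnACA; exact: leq_mul.
Qed.

Lemma polyb_exp T d : polyb T -> polyb (fun n => T n ^ d).
Proof.
move=> H; elim: d => [|d IH]; first exact: polyb_const.
by apply: polyb_le (polyb_mul H IH) => n; rewrite expnS.
Qed.

(** Needed for loops: the cost of a round depends on its index, and a monotone majorant bounds all
    rounds by the last one. *)
Lemma polyb_mono T : polyb T ->
  exists2 T', polyb T' & forall n m, n <= m -> T n <= T' m.
Proof.
move=> [c [d H]]; exists (fun m => c * m.+1 ^ d); first by exists c, d.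
move=> n m le; apply: leq_trans (H n) _; rewrite leq_mul2l.
by case: d {H} => [|d]; rewrite ?orbT // leq_exp2r // ltnS le orbT.
Qed.

Lemma polyb_comp T T' : polyb T -> polyb T' -> polyb (T \o T').
Proof.
move=> [c [d H]] H'; apply: (polyb_le (T' := fun n => c * (T' n + 1) ^ d)).
  by move=> n; rewrite /= addn1.
apply: polyb_mul; first exact: polyb_const.
by apply/polyb_exp/polyb_add => //; exact: polyb_const.
Qed.

Ltac polyb_tac := repeat first
  [ assumption | apply: polyb_const | apply: polyb_id
  | apply: polyb_add | apply: polyb_mul | apply: polyb_exp ].

Section Polytime.
Local Notation prog := (prog 4 void).
Local Notation exec := (@exec 4 void).
Local Notation emit := (@emit 4 void).
Local Notation move := (@move 4 void).
Local Notation append := (@append 4 void).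
Local Notation clear := (@clear 4 void).
Local Notation state := ('I_5 -> content).

Definition tIn : 'I_5 := @Ordinal 5 0 isT.
Definition tIdx : 'I_5 := @Ordinal 5 1 isT.
Definition tPow : 'I_5 := @Ordinal 5 2 isT.
Definition tAcc : 'I_5 := @Ordinal 5 3 isT.
Definition tOut : 'I_5 := ord_max.

Definition state5 (c0 c1 c2 c3 c4 : content) : state :=
  fun i => match val i with 0 => c0 | 1 => c1 | 2 => c2 | 3 => c3 | _ => c4 end.

Definition unary n : content := Parked (nseq n true).
Definition out o : content := Scan o [::].

Lemma upd_in c0 c1 c2 c3 c4 c :
  upd (state5 c0 c1 c2 c3 c4) tIn c = state5 c c1 c2 c3 c4.
Proof. by apply/funext => -[[|[|[|[|[|]]]]] h]. Qed.

Lemma upd_idx c0 c1 c2 c3 c4 c :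
  upd (state5 c0 c1 c2 c3 c4) tIdx c = state5 c0 c c2 c3 c4.
Proof. by apply/funext => -[[|[|[|[|[|]]]]] h]. Qed.

Lemma upd_pow c0 c1 c2 c3 c4 c :
  upd (state5 c0 c1 c2 c3 c4) tPow c = state5 c0 c1 c c3 c4.
Proof. by apply/funext => -[[|[|[|[|[|]]]]] h]. Qed.

Lemma upd_acc c0 c1 c2 c3 c4 c :
  upd (state5 c0 c1 c2 c3 c4) tAcc c = state5 c0 c1 c2 c c4.
Proof. by apply/funext => -[[|[|[|[|[|]]]]] h]. Qed.

Lemma upd_out c0 c1 c2 c3 c4 c :
  upd (state5 c0 c1 c2 c3 c4) tOut c = state5 c0 c1 c2 c3 c.
Proof. by apply/funext => -[[|[|[|[|[|]]]]] h]. Qed.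

Definition updE := (upd_in, upd_idx, upd_pow, upd_acc, upd_out).

(** * Emitting words that depend on an index *)

Definition emits (f : nat -> word) : Prop :=
  exists p : prog, exists2 T, polyb T & forall i o c0 c2 c3,
    exec p (state5 c0 (unary i) c2 c3 (out o))
           (state5 c0 (unary i) c2 c3 (out (o ++ f i))) (T i).

Lemma eq_emits f g : (forall i, f i = g i) -> emits g -> emits f.
Proof. by move=> /funext ->. Qed.

Lemma emits_const w : emits (fun=> w).
Proof.
exists (emit tOut w), (fun=> (size w).+1); first exact: polyb_const.
move=> i o c0 c2 c3.
have := @exec_emit 4 void tOut w (state5 c0 (unary i) c2 c3 (out o)) o erefl.
by rewrite updE.
Qed.

Lemma emits_cat f g : emits f -> emits g -> emits (fun i => f i ++ g i).
Proof.
move=> [p [T pT Hp]] [q [T' pT' Hq]]; exists (Seq p q).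
exists (fun i => T i + T' i); first exact: polyb_add.
by move=> i o c0 c2 c3; rewrite catA; apply: exec_seq; [exact: Hp | exact: Hq].
Qed.

Lemma flatten_nseqS (w : word) n : flatten (nseq n.+1 w) = flatten (nseq n w) ++ w.
Proof. by rewrite -addn1 nseqD flatten_cat /= cats0. Qed.

Lemma emits_repeat w : emits (fun i => flatten (nseq i w)).
Proof.
exists (for_each tIdx (fun=> emit tOut w)).
exists (fun i => i * ((size w).+1 + 5) + 4); first by polyb_tac.
move=> i o c0 c2 c3.
pose F (u : word) := state5 c0 (unary i) c2 c3 (out (o ++ flatten (nseq (size u) w))).
have := @exec_for 4 void tIdx (fun=> emit tOut w) F (size w).+1 (nseq i true).
rewrite /F !updE size_nseq /= cats0; apply => u b v E; rewrite !updE size_rcons.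
have := @exec_emit 4 void tOut w (state5 c0 (Scan u (b :: v)) c2 c3
  (out (o ++ flatten (nseq (size u) w)))) _ erefl.
by rewrite updE -catA -flatten_nseqS.
Qed.

Lemma enc_word_cat v w : enc_word (v ++ w) = flatten [seq [:: true; b] | b <- v] ++ enc_word w.
Proof. by rewrite /enc_word map_cat flatten_cat catA. Qed.

Lemma emits_name k x : emits (fun i => enc_word (name k (subscript_val x i))).
Proof.
have E i : enc_word (name k i) =
    flatten (nseq k [:: true; true]) ++ [:: true; false] ++
    flatten (nseq i [:: true; true]) ++ [:: false].
  by rewrite /name enc_word_cat -cat1s enc_word_cat /enc_word !map_nseq.
apply: (eq_emits (fun i => E (subscript_val x i))).
apply: emits_cat; first exact: emits_const.
apply: emits_cat; first exact: emits_const.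
apply: emits_cat; last exact: emits_const.
case: x => /=; [exact: emits_const | exact: emits_repeat |].
apply: (eq_emits (fun i => flatten_nseqS [:: true; true] i)).
by apply: emits_cat; [exact: emits_repeat | exact: emits_const].
Qed.

Lemma emits_concept C : emits (fun i => enc_concept (inst i C)).
Proof.
elim: C => [k x|||C IHC D IHD|k x C IH] /=; try exact: emits_const.
- by apply: (emits_cat (f := fun=> [:: false; false])); [exact: emits_const | exact: emits_name].
- by apply: (emits_cat (f := fun=> [:: true; false])); [exact: emits_const | exact: emits_cat IHC IHD].
- apply: (emits_cat (f := fun=> [:: true; true])); first exact: emits_const.
  by apply: emits_cat; [exact: emits_name|].
Qed.

Lemma enc_top_pile n :
  enc_concept (top_pile n) = flatten (nseq n [:: true; false; false; true; false]) ++
                             [:: false; true; false].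
Proof. by elim: n => //= n ->. Qed.

Definition enc_hard (L : seq inclusion) : word :=
  flatten [seq true :: enc_inclusion x ++ [:: false] | x <- L].

Lemma enc_hard_cat L L' : enc_hard (L ++ L') = enc_hard L ++ enc_hard L'.
Proof. by rewrite /enc_hard map_cat flatten_cat. Qed.

Lemma emits_label_rules s j L : emits (fun i => enc_hard (label_rules i s j L)).
Proof.
elim: L j => [|[C D] L IH] j /=; first exact: emits_const.
have E i : enc_hard (label_rules i s j ((C, D) :: L)) =
    [:: true; true; false] ++ enc_concept (top_pile i) ++
    ([:: true; false] ++ enc_concept (top_pile s) ++ [:: true; false] ++
     enc_concept (top_pile j)) ++ enc_concept (inst i C) ++
    enc_concept (inst i D) ++ [:: false] ++ enc_hard (label_rules i s j.+1 L).
  by rewrite /enc_hard /= /enc_inclusion /= -?catA /= -?catA /= -?catA /= -?catA.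
apply: (eq_emits E).
apply: emits_cat; first exact: emits_const.
apply: emits_cat.
  apply: (eq_emits enc_top_pile).
  by apply: emits_cat; [exact: emits_repeat | exact: emits_const].
apply: emits_cat; first exact: emits_const.
apply: emits_cat; first exact: emits_concept.
apply: emits_cat; first exact: emits_concept.
by apply: emits_cat; [exact: emits_const | exact: IH].
Qed.

(** * The reduction in polynomial time *)

Definition stage (p : prog) (S S' : word -> state) : Prop :=
  exists2 T, polyb T & forall w, exec p (S w) (S' w) (T (size w)).

Definition stageable (S S' : word -> state) : Prop := exists p, stage p S S'.

Lemma stage_trans S S' S'' : stageable S S' -> stageable S' S'' -> stageable S S''.
Proof.
move=> [p [T pT Hp]] [q [T' pT' Hq]]; exists (Seq p q).
exists (fun n => T n + T' n); first exact: polyb_add.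
by move=> w; exact: exec_seq.
Qed.

Lemma stage_refl S : stageable S S.
Proof.
exists (move tIn Stay), (fun=> 1); first exact: polyb_const.
move=> w; rewrite -[X in exec _ _ X](@upd_id 4 (S w) tIn _ erefl).
exact: exec_move erefl _.
Qed.

Lemma stage_for i body (s : word -> word) (F : word -> word -> state) g T :
  polyb g -> polyb T -> (forall w, size (s w) <= g (size w)) ->
  (forall w u b v, s w = u ++ b :: v ->
     exec (body b) (upd (F w u) i (Scan u (b :: v)))
       (upd (F w (rcons u b)) i (Scan u (b :: v))) (T (size w))) ->
  stageable (fun w => upd (F w [::]) i (Parked (s w)))
            (fun w => upd (F w (s w)) i (Parked (s w))).
Proof.
move=> pg pT sg H; exists (for_each i body), (fun n => g n * (T n + 5) + 4).
  by polyb_tac.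
move=> w; apply: exec_le (exec_for (H w)).
by rewrite leq_add2r leq_mul2r sg orbT.
Qed.

Lemma stage_add_size (i k : 'I_5) (S : word -> state) (s : word -> word) x g :
  i != k -> polyb x -> polyb g -> (forall w, size (s w) <= g (size w)) ->
  (forall w, S w i = Parked (s w)) -> (forall w, S w k = unary (x (size w))) ->
  stageable S (fun w => upd (S w) k (unary (x (size w) + size (s w)))).
Proof.
move=> ik px pg sg Si Sk; exists (for_each i (fun=> append k true)).
exists (fun n => g n * (4 * (x n + g n) + 15) + 4); first by polyb_tac.
move=> w; apply: exec_le (exec_add_size ik (Si w) (Sk w)).
by rewrite leq_add2r leq_mul // leq_add2r leq_mul2l leq_add2l sg.
Qed.

Lemma stage_append (i : 'I_5) (S : word -> state) x :
  polyb x -> (forall w, S w i = unary (x (size w))) ->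
  stageable S (fun w => upd (S w) i (unary (x (size w)).+1)).
Proof.
move=> px Si; exists (append i true), (fun n => 4 * x n + 10); first by polyb_tac.
move=> w; have := exec_append true (Si w).
by rewrite -cats1 -(nseqD _ 1) addn1 size_nseq.
Qed.

Lemma stage_clear (i : 'I_5) (S : word -> state) x :
  polyb x -> (forall w, S w i = unary (x (size w))) ->
  stageable S (fun w => upd (S w) i (unary 0)).
Proof.
move=> px Si; exists (clear i), (fun n => 4 * x n + 10); first by polyb_tac.
by move=> w; have := exec_clear (Si w); rewrite size_nseq.
Qed.

Lemma stage_emit f c0 c2 c3 (o : word -> word) x :
  emits f -> polyb x ->
  stageable (fun w => state5 (c0 w) (unary (x (size w))) (c2 w) (c3 w) (out (o w)))
    (fun w => state5 (c0 w) (unary (x (size w))) (c2 w) (c3 w)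
                (out (o w ++ f (x (size w))))).
Proof.
move=> [p [T pT H]] px; exists p, (T \o x); first exact: polyb_comp.
by move=> w; exact: H.
Qed.

Lemma stage_eq S S' R R' : stageable R R' ->
  (forall w, S w = R w) -> (forall w, S' w = R' w) -> stageable S S'.
Proof. by move=> H /funext -> /funext ->. Qed.

(** For every letter on [tPow], a loop over the input adds [size w] to [tAcc]; the product is then
    moved back to [tPow]. *)
Lemma stage_mul e c1 c4 :
  exists p, stage p
    (fun w => state5 (Parked w) c1 (unary (size w ^ e)) (unary 0) c4)
    (fun w => state5 (Parked w) c1 (unary (size w ^ e.+1)) (unary 0) c4).
Proof.
pose n (w : word) := size w.
have H1 : stageable
    (fun w => state5 (Parked w) c1 (unary (n w ^ e)) (unary 0) c4)
    (fun w => state5 (Parked w) c1 (unary (n w ^ e)) (unary (n w ^ e.+1)) c4).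
  pose F w (u : word) := state5 (Parked w) c1 (unary (n w ^ e)) (unary (size u * n w)) c4.
  pose g x := x ^ e; have pg : polyb g by rewrite /g; polyb_tac.
  have H := @stage_for tPow (fun=> for_each tIn (fun=> append tAcc true))
    (fun w => nseq (n w ^ e) true) F g
    (fun x => x * (4 * (g x * x + x) + 15) + 4) pg.
  apply: stage_eq (H _ _ _) _ _; first by polyb_tac.
  - by move=> w; rewrite size_nseq.
  - move=> w u b v E; rewrite /F !updE.
    have ug : size u <= g (n w).
      by rewrite -(size_nseq (g (n w)) true) E size_cat leq_addr.
    have := @exec_add_size 4 void tIn tAcc
      (state5 (Parked w) c1 (Scan u (b :: v)) (unary (size u * n w)) c4)
      w (size u * n w) isT erefl erefl.
    rewrite updE size_rcons (mulSnr (size u)); apply: exec_le.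
    rewrite leq_add2r leq_mul2l leq_add2r leq_mul2l leq_add2r.
    by rewrite leq_mul2r ug !orbT.
  - by move=> w; rewrite /F updE.
  - by move=> w; rewrite /F updE size_nseq expnSr.
have H2 := @stage_clear tPow (fun w => state5 (Parked w) c1 (unary (n w ^ e))
  (unary (n w ^ e.+1)) c4) (expn^~ e).
have H3 := @stage_add_size tAcc tPow (fun w => state5 (Parked w) c1 (unary 0)
  (unary (n w ^ e.+1)) c4) (fun w => nseq (n w ^ e.+1) true) (fun=> 0) (expn^~ e.+1).
have H4 := @stage_clear tAcc (fun w => state5 (Parked w) c1 (unary (n w ^ e.+1))
  (unary (n w ^ e.+1)) c4) (expn^~ e.+1).
apply: stage_trans H1 _; apply: stage_trans (H2 _ _) _ => //.
  by polyb_tac.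
apply: stage_trans.
  apply: stage_eq (H3 _ _ _ _ _ _) _ (fun=> erefl) => // [||w|w].
  - by polyb_tac.
  - by polyb_tac.
  - by rewrite size_nseq.
  - by rewrite updE.
apply: stage_eq (H4 _ _) _ _ => // [|w|w].
- by polyb_tac.
- by rewrite updE size_nseq add0n.
- by rewrite updE.
Qed.

(** The number of counter digits, chosen so that the counters exceed the running time plus the
    length of the input. *)
Definition bound c d n := c * (n ^ d).+1 + n + 1.

Lemma polyb_bound c d : polyb (bound c d).
Proof.
apply: (polyb_le (T' := fun n => c * (n ^ d + 1) + n + 1)); last by polyb_tac.
by move=> n; rewrite /bound !addn1.
Qed.

(** The recursions on [d] and [c] unfold into the program text: [d] multiplications by [size w],
    then [c] additions of [size w ^ d + 1]. *)
Lemma stage_bound c d c1 c4 :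
  stageable (fun w => state5 (Parked w) c1 (unary 0) (unary 0) c4)
    (fun w => state5 (Parked w) c1 (unary (size w ^ d)) (unary (bound c d (size w))) c4).
Proof.
pose n (w : word) := size w.
have H1 := @stage_append tPow (fun w => state5 (Parked w) c1 (unary 0) (unary 0) c4)
  (fun=> 0) (polyb_const 0) (fun=> erefl).
apply: stage_trans H1 _.
have H2 : stageable
    (fun w => state5 (Parked w) c1 (unary 1) (unary 0) c4)
    (fun w => state5 (Parked w) c1 (unary (n w ^ d)) (unary 0) c4).
  elim: d => [|d IH]; last by apply: stage_trans IH _; exact: stage_mul.
  exact: stage_refl.
apply: stage_trans; first by apply: stage_eq H2 _ (fun=> erefl) => w; rewrite updE.
have pk k : polyb (fun x => k * (x ^ d).+1).
  apply: (polyb_le (T' := fun x => k * (x ^ d + 1))); last by polyb_tac.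
  by move=> x; rewrite addn1.
have H3 : stageable
    (fun w => state5 (Parked w) c1 (unary (n w ^ d)) (unary 0) c4)
    (fun w => state5 (Parked w) c1 (unary (n w ^ d)) (unary (c * (n w ^ d).+1)) c4).
  elim: c => [|c IH]; first exact: stage_refl.
  apply: stage_trans IH _.
  have H := @stage_add_size tPow tAcc
    (fun w => state5 (Parked w) c1 (unary (n w ^ d)) (unary (c * (n w ^ d).+1)) c4)
    (fun w => nseq (n w ^ d) true) (fun x => c * (x ^ d).+1) (expn^~ d) isT.
  apply: stage_trans (H _ _ _ _ _) _ => // [|w|].
  - by polyb_tac.
  - by rewrite size_nseq.
  have H' := @stage_append tAcc
    (fun w => state5 (Parked w) c1 (unary (n w ^ d)) (unary (c * (n w ^ d).+1 + n w ^ d)) c4)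
    (fun x => c * (x ^ d).+1 + x ^ d).
  apply: stage_eq (H' _ _) _ _ => // [|w|w].
  - by apply: polyb_add; [exact: pk | polyb_tac].
  - by rewrite updE size_nseq.
  - by rewrite updE mulSnr addnS.
apply: stage_trans H3 _.
have H4 := @stage_add_size tIn tAcc
  (fun w => state5 (Parked w) c1 (unary (n w ^ d)) (unary (c * (n w ^ d).+1)) c4)
  id (fun x => c * (x ^ d).+1) id isT.
apply: stage_trans (H4 _ _ _ _ _) _ => //; try by polyb_tac.
have H5 := @stage_append tAcc
  (fun w => state5 (Parked w) c1 (unary (n w ^ d)) (unary (c * (n w ^ d).+1 + n w)) c4)
  (fun x => c * (x ^ d).+1 + x).
apply: stage_eq (H5 _ _) _ _ => // [|w|w].
- by apply: polyb_add; [exact: pk | polyb_tac].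
- by rewrite updE.
- by rewrite updE /bound addn1.
Qed.

Lemma nseqS_rcons n : rcons (nseq n true) true = nseq n.+1 true.
Proof. by rewrite -cats1 -(nseqD _ 1) addn1. Qed.

(** The rounds are counted on [tIdx], and round [k] emits [f b k] for the letter [b] that it reads;
    [h w k] collects what the first [k] rounds have emitted. *)
Lemma stage_index_loop (i : 'I_5) (s : word -> word) (f : bool -> nat -> word) g c0 c2 c3
    (o : word -> word) (h : word -> nat -> word) :
  i != tIdx -> i != tOut -> (forall b, emits (f b)) -> polyb g ->
  (forall w, size (s w) <= g (size w)) ->
  (forall w, h w 0 = [::]) ->
  (forall w u b v, s w = u ++ b :: v -> h w (size u).+1 = h w (size u) ++ f b (size u)) ->
  (forall w, state5 (c0 w) (unary 0) (c2 w) (c3 w) (out (o w)) i = Parked (s w)) ->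
  stageable (fun w => state5 (c0 w) (unary 0) (c2 w) (c3 w) (out (o w)))
    (fun w => state5 (c0 w) (unary (size (s w))) (c2 w) (c3 w)
                (out (o w ++ h w (size (s w))))).
Proof.
move=> iX iO ef pg sg h0 hS Si.
have [pt [Tt /polyb_mono[Tt' pTt' leTt] Ht]] := ef true.
have [pf [Tf /polyb_mono[Tf' pTf' leTf] Hf]] := ef false.
pose F w (u : word) := state5 (c0 w) (unary (size u)) (c2 w) (c3 w)
                         (out (o w ++ h w (size u))).
(* Tape [i] is one of the three that [emits] leaves arbitrary, so the scan on it does not disturb
   the emitting programs. *)
have Fi w c : exists c0' c2' c3', forall x y,
    upd (state5 (c0 w) x (c2 w) (c3 w) y) i c = state5 c0' x c2' c3' y.
  case: i iX iO {Si} => -[|[|[|[|[|//]]]]] // h' _ _.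
  - by exists c, (c2 w), (c3 w) => x y; apply/funext => -[[|[|[|[|[|]]]]] h''].
  - by exists (c0 w), c, (c3 w) => x y; apply/funext => -[[|[|[|[|[|]]]]] h''].
  - by exists (c0 w), (c2 w), c => x y; apply/funext => -[[|[|[|[|[|]]]]] h''].
have Fs w u : F w u i = Parked (s w).
  by rewrite -Si /F; case: i iX iO {Si Fi} => -[|[|[|[|[|//]]]]].
have H := @stage_for i (fun b => Seq (if b then pt else pf) (append tIdx true)) s F g
  (fun n => Tt' (g n) + Tf' (g n) + (4 * g n + 10)) pg.
apply: stage_eq (H _ _ _) _ _ => //.
- have comp (T' : nat -> nat) : polyb T' -> polyb (fun n => T' (g n)).
    by move=> pT'; exact: (polyb_comp pT' pg).
  by apply: polyb_add; [apply: polyb_add; exact: comp | polyb_tac].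
- move=> w u b v E; have [c0' [c2' [c3' Fi']]] := Fi w (Scan u (b :: v)).
  rewrite /F !Fi' size_rcons (hS w u b v E) catA.
  have ug : size u <= g (size w).
    by apply: leq_trans (sg w); rewrite E size_cat leq_addr.
  have H1 : exec (if b then pt else pf)
      (state5 c0' (unary (size u)) c2' c3' (out (o w ++ h w (size u))))
      (state5 c0' (unary (size u)) c2' c3' (out ((o w ++ h w (size u)) ++ f b (size u))))
      (Tt' (g (size w)) + Tf' (g (size w))).
    case: b {E Fi'}.
      by apply: exec_le (Ht _ _ _ _ _); exact: leq_trans (leTt _ _ ug) (leq_addr _ _).
    by apply: exec_le (Hf _ _ _ _ _); exact: leq_trans (leTf _ _ ug) (leq_addl _ _).
  apply: exec_seq H1 _; have := @exec_append 4 void tIdx true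
    (state5 c0' (unary (size u)) c2' c3' (out ((o w ++ h w (size u)) ++ f b (size u))))
    (nseq (size u) true) erefl.
  rewrite updE nseqS_rcons size_nseq; apply: exec_le.
  by rewrite leq_add2r leq_mul2l ug orbT.
- move=> w; rewrite upd_id ?Fs // /F /= h0 cats0 //.
- by move=> w; rewrite upd_id ?Fs.
Qed.

Lemma enc_family_loop F m : enc_hard (family_loop F m.+1) =
  enc_hard (family_loop F m) ++ enc_hard (label_rules m 0 0 (loop_rules F)).
Proof.
by rewrite /family_loop -[m.+1]addn1 iotaD map_cat flatten_cat enc_hard_cat /= cats0.
Qed.

Lemma enc_family_letters F w n : enc_hard (family_letters F w n.+1) =
  enc_hard (family_letters F w n) ++
  enc_hard (label_rules n 2 0 (letter_rules F (nth false w n))).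
Proof.
by rewrite /family_letters -[n.+1]addn1 iotaD map_cat flatten_cat enc_hard_cat /= cats0.
Qed.

(** The index tape counts up to the number of digits, where the bound rules are written. It is then
    cleared and counts the letters of the input, at whose end the length rules are written. *)
Lemma stage_output F c d (pre post : word) :
  stageable (fun w => state5 (Parked w) (unary 0) (unary 0) (unary 0) (out [::]))
    (fun w => state5 (Parked w) (unary (size w)) (unary (size w ^ d))
       (unary (bound c d (size w)))
       (out (pre ++ enc_hard (family_inclusions F (bound c d (size w)) w) ++ post))).
Proof.
apply: stage_trans (stage_bound c d _ _) _.
set c2 := fun w : word => unary (size w ^ d).
set m := fun w : word => bound c d (size w).
apply: stage_trans.
  exact: (stage_emit Parked c2 (unary \o m) (fun=> [::]) (emits_const pre) (polyb_const 0)).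
have H1 := @stage_index_loop tAcc (fun w => nseq (m w) true)
  (fun _ i => enc_hard (label_rules i 0 0 (loop_rules F))) (bound c d)
  Parked c2 (unary \o m) (fun=> pre) (fun _ n => enc_hard (family_loop F n))
  isT isT (fun=> emits_label_rules _ _ _) (polyb_bound c d).
apply: stage_trans (H1 _ _ _ _) _ => //.
- by move=> w; rewrite size_nseq.
- by move=> w v b v' _; exact: enc_family_loop.
have H2 := stage_emit Parked c2 (unary \o m) (fun w => pre ++ enc_hard (family_loop F (m w)))
  (emits_label_rules 1 0 (bound_rules F)) (polyb_bound c d).
apply: stage_trans; first by apply: stage_eq H2 _ (fun=> erefl) => w; rewrite size_nseq.
pose o3 w := (pre ++ enc_hard (family_loop F (m w))) ++
             enc_hard (label_rules (m w) 1 0 (bound_rules F)).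
have H3 := @stage_clear tIdx (fun w => state5 (Parked w) (unary (m w)) (c2 w)
  (unary (m w)) (out (o3 w))) (bound c d) (polyb_bound c d) (fun=> erefl).
apply: stage_trans H3 _.
have H4 := @stage_index_loop tIn id
  (fun b i => enc_hard (label_rules i 2 0 (letter_rules F b))) id
  Parked c2 (unary \o m) o3 (fun w n => enc_hard (family_letters F w n))
  isT isT (fun=> emits_label_rules _ _ _) polyb_id (fun=> leqnn _) (fun=> erefl).
apply: stage_trans; first apply: stage_eq (H4 _ _) _ (fun=> erefl) => //.
- move=> w v b v' E; rewrite enc_family_letters E nth_cat ltnn subnn //.
- by move=> w; rewrite updE.
have H5 := stage_emit Parked c2 (unary \o m) (fun w => o3 w ++ enc_hard (family_letters F w (size w)))
  (emits_label_rules 3 0 (length_rules F)) polyb_id.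
apply: stage_trans H5 _.
have H6 := stage_emit Parked c2 (unary \o m) _ (emits_const post) polyb_id.
apply: stage_eq (H6 _) (fun=> erefl) _ => w.
by rewrite /family_inclusions !enc_hard_cat /o3 -!catA.
Qed.

Lemma leading_bits_cells (w : word) j :
  leading_bits (cells void w ++ nseq j None) = w.
Proof. by elim: w => [|b w /= ->] //; case: j. Qed.

Lemma tape_word_scan w t : holds (Scan [::] w) t -> @tape_word void t = w.
Proof.
case=> j ->; rewrite /tape_word /= -[RHS](leading_bits_cells w j).
by case: w => [|b w] //; case: j.
Qed.

Lemma holds_word_tape w :
  holds (Parked w) (tape_move GoLeft (word_tape void w)).
Proof. by case: w => [|b w]; [exists 1 | exists 0; rewrite /= cats0]. Qed.

Lemma polytime_stageable S (f : word -> word) :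
  stageable (fun w => state5 (Parked w) (unary 0) (unary 0) (unary 0) (out [::])) S ->
  (forall w, S w tOut = out (f w)) -> polytime f.
Proof.
move=> [p [T pT Hp]] So.
pose q := Seq (move tOut GoRight) (Seq p (Seq (rewind void tOut) (move tOut GoRight))).
(* In the end all of [f w] lies to the left of the output head, which has made at most [T (size w)]
   moves. *)
have Hf w : size (f w) <= T (size w).
  pose t i := if i == tIn then tape_move GoLeft (word_tape void w)
    else Tape (if i == tOut then [:: None] else [::]) None [::].
  have ht i : holds (state5 (Parked w) (unary 0) (unary 0) (unary 0) (out [::]) i) (t i).
    case: i => -[|[|[|[|[|//]]]]] h;
      by [exact: holds_word_tape | exists 0].
  have [t' h' /(size_tleft_runs tOut)] := Hp w t ht.
  have := h' tOut; rewrite So => -[j -> /=].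
  by rewrite size_cat size_rev size_map addn1 add1n ltnS.
have [c [d H]] : polyb (fun n => 1 + (1 + (T n + ((2 * T n + 2) + 1)))).
  by polyb_tac.
(* The factor [2 ^ d] replaces the base [n.+1] by [n], since [n.+1 <= 2 * n] for positive [n]; the
   additive constant covers [n = 0]. *)
exists (machine_of (Seq (move tIn GoLeft) q)), (c * 2 ^ d), d => w.
pose t0 := cf_tapes (tm_init (machine_of (Seq (move tIn GoLeft) q)) w).
pose t1 := upd t0 tIn (tape_move GoLeft (t0 tIn)).
pose S1 := state5 (Parked w) (unary 0) (unary 0) (unary 0) (unary 0).
have h1 i : holds (S1 i) (t1 i).
  case: i => -[|[|[|[|[|//]]]]] h;
    by [exact: holds_word_tape | exists 0].
have := exec_move (erefl (S1 tOut)) (@holds_parked_right void [::]).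
rewrite updE => E1.
have E2 := exec_seq E1 (exec_seq (Hp w) (exec_seq (exec_rewind (So w))
  (exec_move (upd_same _ _ _) (@holds_parked_right void (f w ++ [::]))))).
have [t2 h2 r2] := E2 t1 h1.
have r1 : runs (pstart (move tIn GoLeft)) t0 t1 1.
  by rewrite /t1 -[X in tape_move _ X]tape_write_thead.
have r := runs_seq r1 r2.
have le : 1 + (1 + (T (size w) + (2 * size (f w) + 2 + 1))) <=
    c * 2 ^ d * size w ^ d + c * 2 ^ d.
  apply: leq_trans (_ : _ <= c * (size w).+1 ^ d) _.
    by apply: leq_trans (H (size w)); rewrite !leq_add2l leq_add2r leq_add2r leq_mul2l Hf.
  rewrite -!mulnA -mulnDr leq_mul2l; apply/orP; right.
  case: (size w) => [|n]; first by rewrite exp1n addn_gt0 expn_gt0 orbT.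
  apply: leq_trans (leq_addr _ _); rewrite -expnMn.
  by case: (d) => [|k] //; rewrite leq_exp2r //; lia.
have [halt tE] := machine_ofP (runs_le le r); split => //.
have := h2 tOut; rewrite upd_same cats0 -tE; exact: tape_word_scan.
Qed.

(** Every inclusion that varies with the input has infinite weight, so the coding [u] of weights
    affects only the constant words written before and after. *)
Theorem polytime_family_wkb F (soft : inclusion * weight) ab q u c d :
  polytime (fun w => enc_instance u (family_wkb F soft ab (bound c d (size w)) w) q).
Proof.
apply: polytime_stageable (@stage_output F c d
  (true :: enc_inclusion soft.1 ++ enc_weight u soft.2)
  (false :: enc_seq (fun p => enc_assertion p.1 ++ enc_weight u p.2) ab ++ enc_query q)) _.
move=> w; congr Scan; rewrite /enc_instance /enc_wkb /family_wkb /= /enc_seq /=.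
have -> L : flatten [seq true :: enc_inclusion x.1 ++ enc_weight u x.2
    | x <- [seq (x, None) | x <- L]] = enc_hard L.
  by rewrite -map_comp.
by rewrite /= -!catA.
Qed.

End Polytime.

(** * Costs *)

Section Cost.
Import Order.TTheory GRing.Theory Num.Theory.
Local Open Scope classical_set_scope.
Local Open Scope ereal_scope.

Lemma ecardE T (A : set T) n : (A #= `I_n)%card -> ecard A = (Posz n)%:E.
Proof.
move=> An; rewrite /ecard; case: pselect => [h|]; last by case; exists n.
congr (Posz _)%:E; apply/card_eq_II.
by apply: card_eq_trans An; rewrite card_eq_sym; exact: projT2 (cid h).
Qed.

Variant ecard_spec T (A : set T) : \bar int -> Prop :=
| EcardFin n of (A #= `I_n)%card : ecard_spec A (Posz n)%:E
| EcardInf of infinite_set A : ecard_spec A +oo.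

Lemma ecardP T (A : set T) : ecard_spec A (ecard A).
Proof.
rewrite /ecard; case: pselect => [h|h].
  by constructor; exact: projT2 (cid h).
by constructor => /finite_setP.
Qed.

Lemma ecard_ge0 T (A : set T) : 0 <= ecard A.
Proof. by case: ecardP => // n _; rewrite lee_fin. Qed.

Lemma ecard_set0 T : ecard (@set0 T) = 0.
Proof. by rewrite (@ecardE _ _ 0) // II0 card_eq00. Qed.

Lemma card_I0 T (A : set T) : (A #= `I_0)%card -> A = set0.
Proof. by rewrite II0 card_eq0 => /eqP. Qed.

Lemma ecard_gt0 T (A : set T) : A <> set0 -> 0 < ecard A.
Proof.
by case: ecardP => // -[/card_I0 //|n _ _]; rewrite lte_fin.
Qed.

Lemma ecard_pair T (x y : T) : x <> y -> ecard [set x; y] = (Posz 2)%:E.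
Proof.
move=> xy; apply/ecardE/eq_cardSP; exists x; first by left.
rewrite (_ : _ `\ _ = [set y]); first exact: card_set1.
apply/seteqP; split => z /=; first by case=> -[].
by move=> ->; split; [right | exact: nesym].
Qed.

Lemma ecard_le2 T (A : set T) x y : x <> y -> A x -> A y ->
  ecard A <= (Posz 2)%:E -> A = [set x; y].
Proof.
move=> xy Ax Ay; case: ecardP => // n + n2.
case: n n2 => [|[|[|//]]] _.
- by move/card_I0 => A0; rewrite A0 in Ax.
- move/eq_cardSP => [z _ /card_I0 A0].
  have E t : A t -> t = z by move=> At; apply: contrapT => tz; have : (A `\ z) t by []; rewrite A0.
  by case: xy; rewrite (E x Ax) (E y Ay).
move/eq_cardSP => [z _ /eq_cardSP[z' _ /card_I0 A0]].
have E t : A t -> t = z \/ t = z'.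
  move=> At; apply: contrapT => /not_orP[tz tz'].
  by have : ((A `\ z) `\ z') t by []; rewrite A0.
apply/seteqP; split => [t /E tE|t [->|->] //].
by move: (E x Ax) (E y Ay) tE xy => [->|->] [->|->] [->|->] xy; by [left|right|case: xy].
Qed.

Lemma cext_dom I C : cext I C `<=` dom I.
Proof.
elim: C => [A|||C IHC D IHD|R C IH] x //=; first exact: cint_dom.
- by case=> /IHC.
- by case=> y /rint_dom[].
Qed.

Definition satisfies I (t : inclusion) := cext I t.1 `<=` cext I t.2.

Lemma vio_inclusion0 I t : vio_inclusion I t = set0 <-> satisfies I t.
Proof.
rewrite /vio_inclusion /satisfies; split=> [v0 x x1|sub].
  apply: contrapT => x2; suff : set0 x by [].
  by rewrite -v0; split=> //; split=> //; exact: cext_dom x1.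
by apply/seteqP; split=> // x [/sub x2 []].
Qed.

Variables (soft : inclusion) (L : seq inclusion) (ab : seq assertion).

Definition strict_wkb : wkb :=
  WKB ((soft, Some 1%N) :: [seq (t, None) | t <- L]) [seq (a, None) | a <- ab].

Definition strict_model I :=
  (forall t, t \in L -> satisfies I t) /\ (forall a, a \in ab -> sat_assertion I a).

Lemma cost_strict_model I : strict_model I ->
  cost strict_wkb I = ecard (vio_inclusion I soft).
Proof.
move=> [sL sab]; rewrite /cost /= big_cons /= !big_map.
rewrite big_seq big1 => [|t tL]; last first.
  by rewrite (vio_inclusion0 I t).2 ?ecard_set0 ?mule0 //; exact: sL.
rewrite big_seq_cond big1 => [|a /andP[aab]]; last by case/asboolP; exact: sab.
by rewrite mul1e !adde0.
Qed.

(** A violated strict axiom contributes [+oo], which no other summand can cancel since all are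
    nonnegative. *)
Lemma strict_model_cost I c : cost strict_wkb I <= (Posz c)%:E ->
  strict_model I.
Proof.
rewrite /cost /= big_cons /= !big_map mul1e => le.
have nNy (x : \bar int) : 0 <= x -> x != -oo by case: x.
have inc_ge0 (s : seq inclusion) : 0 <= \sum_(t <- s) +oo * ecard (vio_inclusion I t).
  by apply: sume_ge0 => t _; rewrite mule_ge0 // ecard_ge0.
have ab_ge0 (s : seq assertion) : 0 <= \sum_(a <- s | ~~ `[< sat_assertion I a >]) (+oo : \bar int).
  by apply: sume_ge0.
split=> [t tL|a aab]; apply: contrapT => nsat.
- move: le; rewrite (perm_big _ (perm_to_rem tL)) big_cons /=.
  rewrite gt0_mulye; last by apply: ecard_gt0 => /vio_inclusion0.
  by rewrite addye ?addey ?addye // nNy // ecard_ge0.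
- move: le; rewrite (perm_big _ (perm_to_rem aab)) big_cons /=.
  case: asboolP => // _ /=.
  by rewrite addye ?addey // nNy // ?adde_ge0 ?ecard_ge0.
Qed.

End Cost.

(** * Binary digits *)

Definition bit i v := odd (v %/ 2 ^ i).

(* The digits of [v] below the [i]-th one are all [1]. *)
Definition ones i v := 2 ^ i %| v.+1.

Lemma ones0 v : ones 0 v.
Proof. exact: dvd1n. Qed.

Lemma divn2_odd x : 2 %| x.+1 = odd x.
Proof. by rewrite dvdn2 /= negbK. Qed.

Lemma onesS i v : ones i.+1 v = ones i v && bit i v.
Proof.
rewrite /ones /bit expnSr; apply/idP/andP => [d|[/dvdnP[q vq] o]].
  have d1 : 2 ^ i %| v.+1 by apply: dvdn_trans d; exact: dvdn_mulr.
  split=> //; case/dvdnP: d1 d => -[//|q] vq.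
  rewrite vq [(_ * 2 ^ i)%N]mulnC dvdn_pmul2l ?expn_gt0 // divn2_odd => oq.
  have -> : v = q * 2 ^ i + (2 ^ i).-1 by move: (expn_gt0 2 i); lia.
  by rewrite divnMDl ?expn_gt0 // divn_small ?addn0 // prednK ?expn_gt0.
case: q vq => // q vq; rewrite vq [(_ * 2 ^ i)%N]mulnC dvdn_pmul2l ?expn_gt0 // divn2_odd.
have vE : v = q * 2 ^ i + (2 ^ i).-1 by move: (expn_gt0 2 i); lia.
move: o; rewrite {1}vE divnMDl ?expn_gt0 // divn_small ?addn0 //.
by rewrite prednK ?expn_gt0.
Qed.

Lemma divnS v d : 0 < d -> v.+1 %/ d = v %/ d + (d %| v.+1).
Proof.
move=> d0; case: (boolP (d %| v.+1)) => [/dvdnP[[//|q] vq]|nd].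
  rewrite vq mulnK //; have -> : v = q * d + d.-1 by lia.
  by rewrite divnMDl // divn_small ?addn0 ?addn1 // prednK.
rewrite addn0 {1}(divn_eq v d) -addnS divnMDl // [X in _ + X]divn_small ?addn0 //.
rewrite ltn_neqAle ltn_pmod // andbT; apply: contra nd => /eqP E.
by rewrite {1}(divn_eq v d) -addnS E -mulSnr dvdn_mull.
Qed.

(** A carry reaches a digit exactly when all lower digits are 1; [divnS] is the arithmetical form of
    this. *)
Lemma bitS i v : bit i v.+1 = bit i v (+) ones i v.
Proof. by rewrite /bit divnS ?expn_gt0 // oddD /ones; case: (_ %| _). Qed.

Lemma bit_mod i m v : i < m -> bit i (v %% 2 ^ m) = bit i v.
Proof.
move=> im; rewrite /bit {2}(divn_eq v (2 ^ m)).
(* The removed multiple of [2 ^ m] contributes an even number to the quotient by [2 ^ i]. *)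
have E : 2 ^ m = 2 ^ (m - i.+1) * 2 * 2 ^ i.
  by rewrite -expnSr -expnD; congr (2 ^ _); lia.
by rewrite [X in _ * X + _]E !mulnA divnMDl ?expn_gt0 // oddD oddM andbF.
Qed.

Lemma bits_of_fun (b : nat -> bool) m :
  exists2 v, v < 2 ^ m & forall i, i < m -> bit i v = b i.
Proof.
elim: m => [|m [v vm vb]]; first by exists 0.
exists (b m * 2 ^ m + v).
  rewrite expnS mul2n -addnn; apply: leq_ltn_trans (_ : 2 ^ m + v < _).
    by rewrite leq_add2r; case: (b m); rewrite ?mul1n ?mul0n.
  by rewrite ltn_add2l.
move=> i; rewrite ltnS leq_eqVlt => /predU1P[->|im].
  by rewrite /bit divnMDl ?expn_gt0 // divn_small // addn0; case: (b m).
by rewrite -(bit_mod _ im) modnMDl modn_small // vb.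
Qed.

Lemma eq_bits m u v : u < 2 ^ m -> v < 2 ^ m ->
  (forall i, i < m -> bit i u = bit i v) -> u = v.
Proof.
elim: m u v => [|m IH] u v; first by case: u v => [|u] [|v].
rewrite !expnS !(mulnC 2) => um vm E.
rewrite (divn_eq u 2) (divn_eq v 2); congr (_ * 2 + _).
  apply: IH; rewrite ?ltn_divLR // => i im.
  by have := E i.+1; rewrite /bit expnS !divnMA; apply.
by rewrite !modn2; congr nat_of_bool; have := E 0 isT; rewrite /bit expn0 !divn1.
Qed.

Lemma ones_max m v : v < 2 ^ m -> ones m v = (v == (2 ^ m).-1).
Proof.
move=> vm; rewrite /ones; apply/idP/eqP => [/dvdn_leq|->].
  by move/(_ isT); lia.
by rewrite prednK ?expn_gt0.
Qed.

Lemma bit_max m i : i < m -> bit i (2 ^ m).-1.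
Proof.
move=> im; have : ones i.+1 (2 ^ m).-1 by rewrite /ones prednK ?expn_gt0 // dvdn_exp2l.
by rewrite onesS => /andP[].
Qed.

(** This turns the increment modulo [2 ^ m] into one condition per digit, which is what the
    inclusions can express. *)
Lemma succ_bits m u v : u < 2 ^ m -> v < 2 ^ m ->
  (forall i, i < m -> bit i v = bit i u (+) ones i u) <-> v = u.+1 %% 2 ^ m.
Proof.
move=> um vm; split=> [E|-> i im]; last by rewrite bit_mod // bitS.
apply: (@eq_bits m) => // [|i im]; first by rewrite ltn_mod expn_gt0.
by rewrite bit_mod // bitS E.
Qed.

Definition shift N (d : direction) v : nat :=
  match d with
  | GoLeft => (v + N.-1) %% N
  | Stay => v
  | GoRight => v.+1 %% N
  end.

Lemma shift_lt N d v : v < N -> shift N d v < N.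
Proof. by move=> vN; case: d => //=; rewrite ltn_mod; exact: leq_ltn_trans vN. Qed.

(** A decrement read backwards is an increment, so [succ_bits] serves both directions. *)
Lemma shift_leftE N u v : u < N -> v < N -> u = v.+1 %% N <-> v = shift N GoLeft u.
Proof.
move=> uN vN /=; split=> ->.
  rewrite modnDml addSnnS prednK ?(leq_ltn_trans _ vN) //.
  by rewrite modnDr modn_small.
rewrite -addn1 modnDml -addnA addn1 prednK ?(leq_ltn_trans _ vN) //.
by rewrite modnDr modn_small.
Qed.

(** * Computations on circular tapes *)

Section Machine.
Variable M : turing_machine.
Local Notation K := (tm_extra M).+1.
Local Notation symbol := (symbol (tm_work M)).

(* The state of [M] and the contents of one cell on each tape. *)
Definition label : finType := (tm_state M * {ffun 'I_K -> symbol})%type.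

Definition label_act (l : label) : tm_state M * {ffun 'I_K -> symbol * direction} :=
  if tm_halt l.1 then (l.1, [ffun j => (l.2 j, Stay)]) else tm_delta l.1 l.2.

Definition label_dir l j := ((label_act l).2 j).2.

(* [c] is the label of the scanned cells before the step, [d] that of the cells
   considered, and [h] tells which of these are scanned. *)
Definition next_label (c d : label) (h : {ffun 'I_K -> bool}) : label :=
  ((label_act c).1, [ffun j => if h j then ((label_act c).2 j).1 else d.2 j]).

Definition letter (w : word) o : option bool := nth None [seq Some b | b <- w] o.

Definition init_label (s : option bool) : label :=
  (tm_start M, [ffun j => if j == ord0 then omap inl s else None]).

(* The label at time [t] of the cells whose positions relative to the heads
   are [p j + 1] modulo [N]: the scanned cells have [p j = N - 1]. *)
Fixpoint circular N (w : word) t (p : 'I_K -> nat) : label :=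
  if t is t'.+1 then
    let c := circular N w t' (fun=> N.-1) in
    let p' j := shift N (label_dir c j) (p j) in
    next_label c (circular N w t' p') [ffun j => p' j == N.-1]
  else init_label (letter w ((p ord0).+1 %% N)).

Definition tape_at (t : tape (tm_work M)) (z : int) : symbol :=
  match z with
  | Posz n => nth None (thead t :: tright t) n
  | Negz n => nth None (tleft t) n
  end.

Definition displacement (d : direction) : int :=
  match d with GoLeft => -1 | Stay => 0 | GoRight => 1 end.

Local Open Scope ring_scope.
Import Order.TTheory GRing.Theory Num.Theory.

Lemma tape_at_step d s t z :
  tape_at (tape_move d (tape_write s t)) z =
  if z + displacement d == 0 then s else tape_at t (z + displacement d).
Proof.
case: d => /=.
- case: z => [[|n]|n].
  + by rewrite (_ : _ + _ = Negz 0) /= ?nth0; last by [].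
  + rewrite (_ : _ + _ = Posz n); last by lia.
    by case: n => [|[|n]].
  + rewrite (_ : _ + _ = Negz n.+1); last by lia.
    by rewrite /= nth_behead.
- by rewrite addr0; case: z => [[|n]|n].
- case: z => [n|[|n]].
  + rewrite (_ : _ + _ = Posz n.+1); last by lia.
    by case: n => [|n]; rewrite /= ?nth0 ?nth_behead.
  + by rewrite (_ : _ + _ = 0).
  + by rewrite (_ : _ + _ = Negz n); last by lia.
Qed.

Definition run_label w t (o : 'I_K -> int) : label :=
  (cf_state (tm_run M t w), [ffun j => tape_at (cf_tapes (tm_run M t w) j) (o j)]).

Lemma run_labelS w t o :
  let c := run_label w t (fun=> 0) in
  let o' j := o j + displacement (label_dir c j) in
  run_label w t.+1 o = next_label c (run_label w t o') [ffun j => o' j == 0].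
Proof.
rewrite /= /run_label /next_label /label_dir /label_act /tm_run /=.
move: (iter t _ _) => c; rewrite /tm_step.
case: ifP => halt /=.
  by congr pair; apply/ffunP => j; rewrite !ffunE /= addr0; case: eqP => [->|].
have -> : [ffun j => tape_at (cf_tapes c j) 0] = [ffun i => thead (cf_tapes c i)].
  by apply/ffunP => j; rewrite !ffunE.
case: tm_delta => q act /=; congr pair; apply/ffunP => j.
by rewrite !ffunE tape_at_step.
Qed.

(** The residue of [z - 1] modulo [N] when the absolute value of [z] is below [N]. The displacement
    by one makes the scanned cell the full counter [N.-1], recognisable by its digits all being
    1. *)
Definition position N (z : int) : nat :=
  if 0 < z then `|z|.-1%N else (N.-1 - `|z|)%N.

Lemma position_shift N d z : (`|z| < N)%N -> (`|(z + displacement d)%R| < N)%N ->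
  position N (z + displacement d) = shift N d (position N z).
Proof.
rewrite /position; case: d => /= zN zdN.
- have [z1|z1] := ltP 1 z.
    rewrite !ifT; try by lia.
    rewrite (_ : _ + _ = `|z|.-2 + N)%N; last by lia.
    by rewrite modnDr modn_small; lia.
  have [->|z0] := eqVneq z 1.
    by rewrite /= add0n modn_small; lia.
  rewrite !ifF; try by lia.
  rewrite (_ : (_ - _ + _)%N = (N.-1 - `|(z + -1)%R| + N)%N); last by lia.
  by rewrite modnDr modn_small; lia.
- by rewrite addr0.
- have [z1|z1] := ltP 0 z.
    by rewrite ifT; [rewrite modn_small; lia | lia].
  have [->|z0] := eqVneq z 0.
    by rewrite /= subn0 prednK ?modnn; lia.
  by rewrite ifF; [rewrite modn_small; lia | lia].
Qed.

Lemma position_scanned N z : (`|z| < N)%N -> (position N z == N.-1) = (z == 0).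
Proof. by rewrite /position; case: ltP; lia. Qed.

(** Cells to the left of the origin wrap around to offsets of at least [N - T], which lie behind the
    input. *)
Lemma tape_at_word w N T z : (`|z| <= T)%N -> (T + size w <= N)%N -> (T < N)%N ->
  tape_at (word_tape _ w) z = omap inl (letter w ((position N z).+1 %% N)).
Proof.
move=> zT TwN TN.
have nth_letter n : nth None [seq Some (inl b) : symbol | b <- w] n = omap inl (letter w n).
  rewrite /letter; elim: w n {TwN} => [|b w IH] [|n] //=; exact: IH.
rewrite /position; case: ltP => [z0|z0].
  case: z zT z0 => [[|n]|n] //= nT _; rewrite modn_small; last by lia.
  by rewrite nth_behead nth_letter.
case: z zT z0 => [[|n]|n] //= nT _.
  rewrite subn0 prednK ?modnn -?nth_letter; last by lia.
  by rewrite nth0.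
rewrite modn_small; last by lia.
by rewrite nth_nil /letter nth_default // size_map; lia.
Qed.

(** Each step back in time enlarges an offset by at most one. All offsets met thus stay within [T],
    below [N], and the closing of the tape goes unnoticed. *)
Lemma circular_run N w T t (o : 'I_K -> int) :
  (T + size w <= N)%N -> (T < N)%N -> (t <= T)%N -> (forall j, `|o j| <= T - t)%N ->
  circular N w t (fun j => position N (o j)) = run_label w t o.
Proof.
move=> TwN TN; elim: t o => [|t IH] o tT oT.
  rewrite /circular /run_label /init_label /tm_run /=; congr pair.
  apply/ffunP => j; rewrite !ffunE; case: eqP => [->|_].
    by rewrite (@tape_at_word w N T) //; have := oT ord0; rewrite subn0.
  by case: (o j) => [[|n]|n] //=; rewrite nth_nil.
rewrite run_labelS [LHS]/=.
have -> : circular N w t (fun=> N.-1) = run_label w t (fun=> 0).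
  rewrite -IH //; last by move: tT; lia.
  by congr circular; apply/funext => j; rewrite /position /= subn0.
set c := run_label w t (fun=> 0).
have o'T j : (`|(o j + displacement (label_dir c j))%R| <= T - t)%N.
  by have := oT j; case: label_dir => /=; lia.
have oN j : (`|o j| < N)%N by have := oT j; lia.
have o'N j : (`|(o j + displacement (label_dir c j))%R| < N)%N.
  by have := o'T j; lia.
have pE j : shift N (label_dir c j) (position N (o j)) =
            position N (o j + displacement (label_dir c j)).
  by rewrite position_shift.
congr next_label; last by apply/ffunP => j; rewrite !ffunE pE position_scanned.
rewrite -IH //; last by move: tT; lia.
by congr circular; apply/funext.
Qed.

Lemma circular_halted N w t p : tm_halt (circular N w t (fun=> N.-1)).1 ->
  (circular N w t.+1 p).1 = (circular N w t (fun=> N.-1)).1.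
Proof. by move=> /= h; rewrite /label_act h. Qed.

(** A halting state persists, even at times for which [circular_run] no longer guarantees the cell
    contents; so it can be read off at any later time. *)
Lemma circular_final N w T n :
  (T + size w <= N)%N -> (T <= n < N)%N -> tm_halt (cf_state (tm_run M T w)) ->
  (circular N w n (fun=> N.-1)).1 = cf_state (tm_run M T w).
Proof.
move=> TwN /andP[Tn nN] halt.
have E0 : (circular N w T (fun=> N.-1)).1 = cf_state (tm_run M T w).
  have := @circular_run N w T T (fun=> 0) TwN (leq_ltn_trans Tn nN) (leqnn T).
  rewrite /position /= subn0 => -> // j; exact: leq0n.
rewrite -(subnKC Tn); elim: (n - T)%N => [|k IH]; first by rewrite addn0.
by rewrite addnS circular_halted // IH.
Qed.

End Machine.

(** * Lists of indexed inclusions *)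

Fixpoint for_all (T : Type) (P : T -> Prop) (s : seq T) : Prop :=
  if s is x :: s' then P x /\ for_all P s' else True.

Lemma for_all_cat T (P : T -> Prop) s1 s2 :
  for_all P (s1 ++ s2) <-> for_all P s1 /\ for_all P s2.
Proof. by elim: s1 => [|x s IH] /=; [split=> [|[]] | rewrite IH; tauto]. Qed.

Lemma for_all_map (S : eqType) T (P : T -> Prop) (f : S -> T) s :
  for_all P [seq f x | x <- s] <-> (forall x, x \in s -> P (f x)).
Proof.
elim: s => [|x s IH] /=; first by split.
rewrite IH; split=> [[Px Ps] y|Ps]; first by rewrite inE => /predU1P[->|/Ps].
by split=> [|y ys]; apply: Ps; rewrite inE ?eqxx ?ys ?orbT.
Qed.

Lemma for_all_flatten (S : eqType) T (P : T -> Prop) (f : S -> seq T) s :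
  for_all P (flatten [seq f x | x <- s]) <-> (forall x, x \in s -> for_all P (f x)).
Proof.
elim: s => [|x s IH] /=; first by split.
rewrite for_all_cat IH; split=> [[Px Ps] y|Ps].
  by rewrite inE => /predU1P[->|/Ps].
by split=> [|y ys]; apply: Ps; rewrite inE ?eqxx ?ys ?orbT.
Qed.

Lemma for_all_mem (S : eqType) (P : S -> Prop) s :
  for_all P s <-> (forall x, x \in s -> P x).
Proof. by rewrite -(for_all_map P id) map_id. Qed.

Definition tsat I i (t : template * template) : Prop :=
  forall x, cext I (inst i t.1) x -> cext I (inst i t.2) x.

Lemma cext_top_pile I n x : cext I (top_pile n) x <-> dom I x.
Proof. by elim: n => //= n IH; split=> [[]|d] //; split=> //; exact/IH. Qed.

Lemma label_rules_sat I i s j L :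
  for_all (satisfies I) (label_rules i s j L) <-> for_all (tsat I i) L.
Proof.
elim: L j => [|[C D] L IH] j //=; rewrite IH.
suff -> : satisfies I
    (CAnd (top_pile i) (CAnd (top_pile s) (CAnd (top_pile j) (inst i C))), inst i D)
    <-> tsat I i (C, D) by [].
split=> H x /= Cx; last by apply: H; case: Cx => _ [_ []].
by apply: H; have := cext_dom Cx; rewrite /= !cext_top_pile.
Qed.

Definition family_model I F m w : Prop :=
  [/\ forall i, i < m -> for_all (tsat I i) (loop_rules F),
      for_all (tsat I m) (bound_rules F),
      forall p, p < size w -> for_all (tsat I p) (letter_rules F (nth false w p)) &
      for_all (tsat I (size w)) (length_rules F)].

Lemma family_inclusions_sat I F m w :
  (forall t, t \in family_inclusions F m w -> satisfies I t) <-> family_model I F m w.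
Proof.
rewrite -for_all_mem /family_inclusions !for_all_cat !for_all_flatten !label_rules_sat.
split=> [[[H1 H2] [H3 H4]]|[H1 H2 H3 H4]]; split=> //.
- by move=> i im; rewrite -(label_rules_sat I i 0 0); apply: H1; rewrite mem_iota.
- by move=> p pn; rewrite -(label_rules_sat I p 2 0); apply: H3; rewrite mem_iota.
- by split=> // i; rewrite mem_iota label_rules_sat => /H1.
- by split=> // p; rewrite mem_iota label_rules_sat => /H3.
Qed.

(** * Distinctness of the labelled inclusions *)

Fixpoint pile_height (C : concept) : nat :=
  if C is CAnd CTop C' then (pile_height C').+1 else 0.

(** The three pile heights give the subscript, the group and the rank within the list; they tell
    inclusions apart whatever their proper contents. *)
Definition rule_key (t : inclusion) : nat * nat * nat :=
  if t.1 is CAnd A (CAnd B (CAnd C _)) then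
    (pile_height A, pile_height B, pile_height C)
  else (0, 0, 0).

Lemma pile_heightE n : pile_height (top_pile n) = n.
Proof. by elim: n => //= n ->. Qed.

Lemma rule_key_label i s j L :
  [seq rule_key t | t <- label_rules i s j L] = [seq (i, s, k) | k <- iota j (size L)].
Proof.
by elim: L j => [|[C D] L IH] j //=; rewrite IH /rule_key /= !pile_heightE.
Qed.

Lemma uniq_key_label i s j L :
  uniq [seq rule_key t | t <- label_rules i s j L].
Proof. by rewrite rule_key_label map_inj_uniq ?iota_uniq // => x y []. Qed.

Lemma mem_key_label k i s j L :
  k \in [seq rule_key t | t <- label_rules i s j L] -> k.1 = (i, s).
Proof. by rewrite rule_key_label => /mapP[x _ ->]. Qed.

Lemma mem_key_labels k s n (L : nat -> seq (template * template)) :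
  k \in [seq rule_key t | t <- flatten [seq label_rules i s 0 (L i) | i <- iota 0 n]] ->
  k.1.1 < n /\ k.1.2 = s.
Proof.
case/mapP => t /flatten_mapP[i]; rewrite mem_iota => /= im tl ->.
by have /mem_key_label -> := map_f rule_key tl.
Qed.

Lemma uniq_key_labels s n (L : nat -> seq (template * template)) :
  uniq [seq rule_key t | t <- flatten [seq label_rules i s 0 (L i) | i <- iota 0 n]].
Proof.
elim: n => // n IH; rewrite -addn1 iotaD map_cat flatten_cat map_cat cat_uniq IH /=.
rewrite cats0 uniq_key_label andbT; apply/hasPn => k /mem_key_label kE.
by apply/negP => /mem_key_labels; rewrite kE /= ltnn; case.
Qed.

Lemma uniq_family_inclusions F m w : uniq (family_inclusions F m w).
Proof.
apply: (map_uniq (f := rule_key)); rewrite /family_inclusions !map_cat.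
rewrite !cat_uniq !uniq_key_label !uniq_key_labels /= !andbT.
apply/and3P; split; apply/hasPn => k.
- by move=> /mem_key_label kE; apply/negP => /mem_key_labels; rewrite kE /=; case.
- rewrite mem_cat => kr; rewrite mem_cat; apply/negP => kl.
  have s23 : k.1.2 \in [:: 2; 3].
    by case/orP: kr => [/mem_key_labels[_ ->]|/mem_key_label ->].
  have s01 : k.1.2 \in [:: 0; 1].
    by case/orP: kl => [/mem_key_labels[_ ->]|/mem_key_label ->].
  by move: s23 s01; rewrite !inE => /orP[] /eqP ->.
- by move=> /mem_key_label kE; apply/negP => /mem_key_labels; rewrite kE /=; case.
Qed.

Lemma label_rules_and i s j L t : t \in label_rules i s j L ->
  exists C D, t.1 = CAnd C D.
Proof.
elim: L j => [|[C D] L IH] j //=; rewrite inE => /predU1P[->|/IH //].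
by exists (top_pile i), (CAnd (top_pile s) (CAnd (top_pile j) (inst i C))).
Qed.

(** This keeps the strict inclusions distinct from the soft one, whose left-hand side is a concept
    name. *)
Lemma family_inclusions_and F m w t : t \in family_inclusions F m w ->
  exists C D, t.1 = CAnd C D.
Proof.
rewrite !mem_cat => /orP[/orP[]|/orP[]]; try exact: label_rules_and.
- by case/flatten_mapP => i _; exact: label_rules_and.
- by case/flatten_mapP => i _; exact: label_rules_and.
Qed.

Lemma wf_family_wkb F A D ab m w : uniq ab ->
  wf_wkb (family_wkb F ((CName A, D), Some 1) [seq (a, None) | a <- ab] m w).
Proof.
move=> uab; rewrite /wf_wkb /= /unzip1 /unzip2 -!map_comp.
rewrite (eq_map (g := id)) // map_id uniq_family_inclusions andbT.
rewrite (eq_map (g := id)) // map_id uab /= andbC !all_map.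
apply/andP; split; first by apply/andP; split; apply/allP.
by apply/negP => /family_inclusions_and[C [C' []]].
Qed.

(** * The inclusions describing a computation *)

Section Reduction.
Variable M : turing_machine.
Local Notation K := (tm_extra M).+1.
Local Notation label := (label M).

(* A node stands for a time and, for each tape, a cell given relatively to the
   head.  Counter [0] holds [2 ^ m - 1 - t] at time [t]; counter [j + 1] holds
   the argument [p j] of [circular], so that it is full for the scanned cell.
   [AOnes b r] with subscript [i] tells whether the digits of counter [r] below
   the [i]-th one are all [1]; [APos] with subscript [p] holds if the cell of
   the first tape is the [p]-th one to the right of the head, [ABeyond] if it
   lies behind the input when the head is at the origin, and [AInit s] if it
   initially contains [s]. *)
Inductive atom :=
| ANode | ABool | ATrue | AFalse | AStart | AAcc | ABeyond | APos
| AInit of option bool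
| AOnes of bool & nat
| ALab of label.

Definition atom_key (a : atom) : nat * nat :=
  match a with
  | ANode => (0, 0) | ABool => (1, 0) | ATrue => (2, 0) | AFalse => (3, 0)
  | AStart => (4, 0) | AAcc => (5, 0) | ABeyond => (6, 0) | APos => (7, 0)
  | AInit s => (8, pickle s)
  | AOnes b r => (9, pickle (b, r))
  | ALab l => (10, pickle l)
  end.

(* Kept opaque, since evaluating [pickle] is infeasible. *)
Fact atom_code_exists : {f : atom -> nat | injective f}.
Proof.
exists (pickle \o atom_key) => a b /(pcan_inj pickleK).
case: a b => [||||||||s|c r|l] [||||||||s'|c' r'|l'] //= [].
- by move/(pcan_inj pickleK) => ->.
- by move/(pcan_inj pickleK) => [-> ->].
- by move/(pcan_inj pickleK) => ->.
Qed.

Definition atom_code : atom -> nat := sval atom_code_exists.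

Lemma atom_code_inj : injective atom_code.
Proof. exact: svalP atom_code_exists. Qed.

(* From time [t + 1] to time [t], the role [RConf] leads to the scanned cells
   and [RCell] to the cells of the node; [RPrev] leads to the left neighbour of
   the cell of the first tape.  [RBit r] with subscript [i] leads to the
   individual representing the [i]-th digit of counter [r]. *)
Inductive role := RConf | RCell | RPrev | RBit of nat.

Definition role_code (q : role) : nat :=
  match q with RConf => 0 | RCell => 1 | RPrev => 2 | RBit r => r.+3 end.

Lemma role_code_inj : injective role_code.
Proof. by case=> [|||r] [|||r'] //= [->]. Qed.

Definition TA (a : atom) (x : subscript) : template := TName (atom_code a) x.
Definition TE (q : role) (C : template) : template := TEx (role_code q) Zero C.
Definition TBit (b : bool) (r : nat) : template :=
  TEx (role_code (RBit r)) Here (TA (if b then ATrue else AFalse) Zero).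
Definition TOnes (b : bool) (r : nat) (x : subscript) : template := TA (AOnes b r) x.

(** In order: a digit exists, it has only one value, three rules compute [AOnes] digit by digit, and
    the start node has counter 0 empty (the last time) and the others full (the scanned cells). *)
Definition counter_rules r : seq (template * template) :=
  [:: (TA ANode Zero, TEx (role_code (RBit r)) Here (TA ABool Zero));
      (TAnd (TBit true r) (TBit false r), TBot);
      (TAnd (TOnes true r Here) (TBit true r), TOnes true r Next);
      (TOnes false r Here, TOnes false r Next);
      (TBit false r, TOnes false r Next);
      (TA AStart Zero, TBit (r != 0) r)].

(** By [succ_bits] the new digit is [b (+) o], with [o] the carry, so its negation is excluded. For
    [GoLeft] the carry is taken at the target, of which the source is the successor. *)
Definition shift_rule (G : template) q r d (bo : bool * bool) : template * template :=
  let: (b, o) := bo in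
  match d with
  | GoRight => (TAnd G (TAnd (TAnd (TOnes o r Here) (TBit b r))
                             (TE q (TBit (~~ (b (+) o)) r))), TBot)
  | GoLeft => (TAnd G (TAnd (TBit (~~ (b (+) o)) r)
                            (TE q (TAnd (TOnes o r Here) (TBit b r)))), TBot)
  | Stay => (TAnd G (TAnd (TBit b r) (TE q (TBit (~~ b) r))), TBot)
  end.

Definition shift_rules G q r d : seq (template * template) :=
  [seq shift_rule G q r d bo | bo <- enum {: bool * bool}].

(** The moves of the heads are read off the label of the scanned cells, hence the guard along
    [RConf]. *)
Definition cell_rules (lj : label * 'I_K) : seq (template * template) :=
  shift_rules (TE RConf (TA (ALab lj.1) Zero)) RCell lj.2.+1 (label_dir lj.1 lj.2).

Definition scanned (h : {ffun 'I_K -> bool}) : template :=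
  foldr (fun j C => TAnd (TOnes (h j) j.+1 Here) C) TTop (enum 'I_K).

Definition next_rule (cdh : label * label * {ffun 'I_K -> bool}) : template * template :=
  let: (c, d, h) := cdh in
  (TAnd (TE RConf (TA (ALab c) Zero))
     (TAnd (TE RCell (TAnd (TA (ALab d) Zero) (scanned h))) (TOnes false 0 Here)),
   TA (ALab (next_label c d h)) Zero).

Definition init_rule (s : option bool) : template * template :=
  (TAnd (TOnes true 0 Here) (TA (AInit s) Zero), TA (ALab (init_label M s)) Zero).

(** The second case forbids spurious acceptance; without it an optimal model could satisfy the query
    at will, which would spoil possible entailment. *)
Definition accept_rule (l : label) : template * template :=
  if tm_accept l.1 then (TA (ALab l) Zero, TA AAcc Zero)
  else (TAnd (TA (ALab l) Zero) (TA AAcc Zero), TBot).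

(** Incrementing counter 0 makes [RConf] and [RCell] lead one step back in time. Along [RConf] no
    position counter may have a digit 0, as the scanned cells have full ones. *)
Definition run_loop_rules : seq (template * template) :=
  flatten [seq counter_rules r | r <- iota 0 K.+1] ++
  (shift_rules TTop RConf 0 GoRight ++ shift_rules TTop RCell 0 GoRight ++
   shift_rules TTop RPrev 1 GoLeft) ++
  [seq (TE RConf (TBit false j), TBot) | j <- iota 1 K] ++
  flatten [seq cell_rules lj | lj <- enum {: label * 'I_K}].

(** At subscript [m] the atoms [AOnes] concern whole counters: counter 0 is full at time 0 only, and
    counter 1 only if the cell of the first tape is scanned. *)
Definition run_bound_rules : seq (template * template) :=
  [:: (TA ANode Zero, TE RConf (TA ANode Zero));
      (TA ANode Zero, TE RCell (TA ANode Zero));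
      (TA ANode Zero, TE RPrev (TA ANode Zero));
      (TOnes true 1 Here, TA APos Zero);
      (TAnd (TE RPrev (TA ABeyond Zero)) (TOnes false 1 Here), TA ABeyond Zero);
      (TA ABeyond Zero, TA (AInit None) Zero)] ++
  [seq (TA ANode Zero, TOnes true r Zero) | r <- iota 0 K.+1] ++
  [seq next_rule cdh | cdh <- enum {: label * label * {ffun 'I_K -> bool}}] ++
  [seq init_rule s | s <- enum {: option bool}] ++
  [seq accept_rule l | l <- enum label].

Definition run_letter_rules b : seq (template * template) :=
  [:: (TE RPrev (TA APos Here), TA APos Next); (TA APos Here, TA (AInit (Some b)) Zero)].

Definition run_length_rules : seq (template * template) :=
  [:: (TA APos Here, TA ABeyond Zero)].

Definition run_rules : rule_family :=
  RuleFamily run_loop_rules run_bound_rules run_letter_rules run_length_rules.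

Variables (m : nat) (w : word).
Local Notation N := (2 ^ m).

(** * What holds in every model of the inclusions with a two-valued [Bool] *)

Section Soundness.
Variable I : interp.

Definition holds_at a i (x : elt I) : Prop := cint I (name (atom_code a) i) x.
Definition bit_at b r i (x : elt I) : Prop := cext I (inst i (TBit b r)) x.
Definition node x := holds_at ANode 0 x.
Definition edge q x y : Prop := rint I (name (role_code q) 0) (x, y).
Definition counter_at r v x : Prop :=
  v < N /\ forall i, i < m -> bit_at (bit i v) r i x.

Hypothesis model : family_model I run_rules m w.
Hypothesis bool_at : forall x, holds_at ABool 0 x -> holds_at ATrue 0 x \/ holds_at AFalse 0 x.

Lemma loop_rules_at i : i < m ->
  [/\ forall r, r <= K -> for_all (tsat I i) (counter_rules r),
      [/\ for_all (tsat I i) (shift_rules TTop RConf 0 GoRight),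
          for_all (tsat I i) (shift_rules TTop RCell 0 GoRight) &
          for_all (tsat I i) (shift_rules TTop RPrev 1 GoLeft)],
      forall (j : 'I_K) x y, edge RConf x y -> ~ bit_at false j.+1 i y &
      forall lj, for_all (tsat I i) (cell_rules lj)].
Proof.
case: model => H _ _ _ im.
have {H} : for_all (tsat I i) run_loop_rules := H i im.
move=> /for_all_cat[/for_all_flatten H1 /for_all_cat[/for_all_cat[H2]]].
move=> /for_all_cat[H3 H4] /for_all_cat[/for_all_map H5 /for_all_flatten H6].
split=> //.
- by move=> r rK; apply: H1; rewrite mem_iota add0n ltnS.
- move=> j x y xy by'; apply: (H5 j.+1 _ x).
    by rewrite mem_iota add1n [j.+1 < _]ltnS ltn_ord.
  by exists y.
- by move=> lj; apply: H6; rewrite mem_enum.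
Qed.

Lemma bound_rules_at :
  [/\ [/\ tsat I m (TA ANode Zero, TE RConf (TA ANode Zero)),
          tsat I m (TA ANode Zero, TE RCell (TA ANode Zero)) &
          tsat I m (TA ANode Zero, TE RPrev (TA ANode Zero))],
      [/\ tsat I m (TOnes true 1 Here, TA APos Zero),
          tsat I m (TAnd (TE RPrev (TA ABeyond Zero)) (TOnes false 1 Here), TA ABeyond Zero) &
          tsat I m (TA ABeyond Zero, TA (AInit None) Zero)],
      forall r, r <= K -> tsat I m (TA ANode Zero, TOnes true r Zero),
      forall cdh, tsat I m (next_rule cdh) &
      (forall s, tsat I m (init_rule s)) /\
      (forall l, tsat I m (accept_rule l))].
Proof.
case: model => _ H _ _; have {H} : for_all (tsat I m) run_bound_rules := H.
move=> /for_all_cat[[H1 [H2 [H3 [H4 [H5 [H6 _]]]]]] /for_all_cat[/for_all_map H7]].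
move=> /for_all_cat[/for_all_map H8 /for_all_cat[/for_all_map H9 /for_all_map H10]].
split=> //.
- by move=> r rK; apply: H7; rewrite mem_iota add0n ltnS.
- by move=> cdh; apply: H8; rewrite mem_enum.
- by split=> [s|l]; [apply: H9 | apply: H10]; rewrite mem_enum.
Qed.

Lemma word_rules_at :
  [/\ forall p, p < size w -> tsat I p (TE RPrev (TA APos Here), TA APos Next),
      forall p, p < size w -> tsat I p (TA APos Here, TA (AInit (Some (nth false w p))) Zero) &
      tsat I (size w) (TA APos Here, TA ABeyond Zero)].
Proof.
case: model => _ _ H H'; split=> [p /H[]|p /H[_ []]|] //.
by case: (H' : for_all _ run_length_rules).
Qed.

Lemma edge_node x : node x ->
  [/\ exists2 y, edge RConf x y & node y,
      exists2 y, edge RCell x y & node y &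
      exists2 y, edge RPrev x y & node y].
Proof.
have [[H1 H2 H3] _ _ _ _] := bound_rules_at.
by move=> nx; split; [apply: H1 | apply: H2 | apply: H3].
Qed.

Lemma bit_atP r i x : node x -> r <= K -> i < m ->
  bit_at true r i x \/ bit_at false r i x.
Proof.
move=> nx rK /loop_rules_at[/(_ r rK) [/(_ x nx) [y xy /bool_at[]]]] By _ _ _.
- by left; exists y.
- by right; exists y.
Qed.

Lemma counter_at_exists r x : node x -> r <= K -> exists v, counter_at r v x.
Proof.
move=> nx rK; have [v vN vb] := bits_of_fun (fun i => `[< bit_at true r i x >]) m.
exists v; split=> // i im; rewrite vb //; case: asboolP => // nb.
by case: (bit_atP nx rK im).
Qed.

Lemma ones_at r v x i : node x -> r <= K -> counter_at r v x -> i <= m ->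
  holds_at (AOnes (ones i v) r) i x.
Proof.
move=> nx rK [vN vb]; elim: i => [_|i IH im].
  by rewrite ones0; by have [_ _ H _ _] := bound_rules_at; exact: (H r rK x nx).
have := IH (ltnW im); have := vb i im; rewrite onesS.
have [/(_ r rK) [_ [_ [H1 [H2 [H3 _]]]]] _ _ _] := loop_rules_at im.
case: (ones i v); case: (bit i v) => Hb Ho /=.
- by apply: H1; split.
- exact: H3.
- exact: H2.
- exact: H3.
Qed.

(** The node [y] has some counter value [u]; a digit in which [u] differs from the shifted value
    would put [x] into bottom. *)
Lemma shift_at G q r d v x y :
  (forall i, i < m -> for_all (tsat I i) (shift_rules G q r d)) ->
  (forall i, cext I (inst i G) x) -> r <= K -> node x -> node y -> edge q x y ->
  counter_at r v x -> counter_at r (shift N d v) y.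
Proof.
move=> Hs Gx rK nx ny xy cv; have [u cu] := counter_at_exists ny rK.
suff <- : u = shift N d v by [].
have [[vN vb] [uN ub]] := (cv, cu).
have Hr i b o : i < m -> ~ cext I (inst i (shift_rule G q r d (b, o)).1) x.
  move=> im Hx; have /for_all_map/(_ (b, o)) := Hs i im; rewrite mem_enum => /(_ isT x Hx).
  by case: (d).
have neg a c : a <> c -> a = ~~ c by case: a; case: c.
case: d Hs Hr => Hs Hr.
- apply/shift_leftE => //; apply/succ_bits => // i im.
  apply/eqP; apply: contrapT => /negP/eqP/neg E; apply: (Hr i (bit i u) (ones i u) im).
  split; first exact: Gx; split; first by rewrite -E; exact: vb.
  by exists y => //; split; [exact: ones_at (ltnW im) | exact: ub].
- apply: (eq_bits uN) => //= i im.
  apply/eqP; apply: contrapT => /negP/eqP/neg E; apply: (Hr i (bit i v) true im).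
  split; first exact: Gx; split; first exact: vb.
  by exists y => //; rewrite -E; exact: ub.
- apply/(succ_bits vN uN) => i im.
  apply/eqP; apply: contrapT => /negP/eqP/neg E; apply: (Hr i (bit i v) (ones i v) im).
  split; first exact: Gx; split.
    by split; [exact: ones_at (ltnW im) | exact: vb].
  by exists y => //; rewrite -E; exact: ub.
Qed.

Lemma full_at r x v : node x -> r <= K -> v < N ->
  (forall i, i < m -> ~ bit_at false r i x) -> counter_at r v x -> v = N.-1.
Proof.
move=> nx rK vN nb [_ vb]; apply/eqP; rewrite -ones_max //.
suff H i : i <= m -> ones i v by exact: H.
elim: i => [|i IH] im; first exact: ones0.
by rewrite onesS IH ?(ltnW im) //=; apply: contra_notT (nb i im) => /negbTE <-; exact: vb.
Qed.

Lemma N_gt0 : 0 < N. Proof. by rewrite expn_gt0. Qed.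

(** Induction along [RPrev] from the cell at offset 0, where counter 1 is full. At offset [size w]
    the chain of [APos] hands over to [ABeyond], which then propagates until counter 1 becomes full
    again. *)
Lemma position_at o x : o < N -> node x -> counter_at 1 ((o + N.-1) %% N) x ->
  (o <= size w -> holds_at APos o x) /\ (size w <= o -> holds_at ABeyond 0 x).
Proof.
have [W1 _ W3] := word_rules_at; have [_ [B1 B2 _] _ _ _] := bound_rules_at.
elim: o x => [|o IH] x oN nx cx.
  have P0 : holds_at APos 0 x.
    apply: B1; have := @ones_at 1 _ x m nx isT cx (leqnn m).
    by rewrite ones_max ?ltn_mod ?N_gt0 // add0n modn_small ?eqxx ?prednK ?N_gt0.
  by split=> //; rewrite leqn0 => /eqP w0; move: W3; rewrite w0 => /(_ x P0).
have [_ _ [y xy ny]] := edge_node nx.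
have vE : (o.+1 + N.-1) %% N = o.
  by rewrite addSnnS prednK ?N_gt0 // modnDr modn_small // ltnW.
have cy : counter_at 1 ((o + N.-1) %% N) y.
  have := @shift_at TTop RPrev 1 GoLeft _ x y _ _ isT nx ny xy cx; rewrite vE; apply.
    by move=> i /loop_rules_at[_ []].
  by move=> i; exact: cint_dom nx.
have [Po Bo] := IH y (ltnW oN) ny cy.
have Ps : o < size w -> holds_at APos o.+1 x.
  by move=> ow; apply: (W1 o ow x); exists y => //; apply: Po; exact: ltnW.
split=> // wo; have [ow|ow] := ltnP o (size w).
  have E : size w = o.+1 by apply/eqP; rewrite eqn_leq wo ow.
  by move: W3 (Ps ow); rewrite E => W3 /W3.
apply: B2; split; first by exists y => //; exact: Bo.
have := @ones_at 1 _ x m nx isT cx (leqnn m); rewrite vE ones_max ?(ltnW oN) //.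
by rewrite ltn_eqF //; move: oN; lia.
Qed.

Lemma letter_at o x : o < N -> node x -> counter_at 1 ((o + N.-1) %% N) x ->
  holds_at (AInit (letter w o)) 0 x.
Proof.
move=> oN nx cx; have [Po Bo] := position_at oN nx cx.
have [_ W2 _] := word_rules_at; have [_ [_ _ B3] _ _ _] := bound_rules_at.
have [ow|ow] := ltnP o (size w).
  by rewrite /letter (nth_map false) //; apply: (W2 o ow); apply: Po; exact: ltnW.
by rewrite /letter nth_default ?size_map //; apply: B3; exact: Bo.
Qed.

Lemma cext_scanned i h x : cext I (inst i (scanned h)) x <->
  dom I x /\ forall j, holds_at (AOnes (h j) j.+1) i x.
Proof.
rewrite /scanned; have : forall j, j \in enum 'I_K by move=> j; rewrite mem_enum.
move=> all_j; transitivity (dom I x /\ forall j, j \in enum 'I_K ->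
  holds_at (AOnes (h j) j.+1) i x); last first.
  by split=> -[dx H]; split=> // j; apply: H.
elim: (enum _) {all_j} => [|j s IH] /=; first by split=> [|[]].
rewrite IH; split=> [[hj [dx hs]]|[dx hs]].
  by split=> // k; rewrite inE => /predU1P[->|/hs].
split; first by apply: hs; rewrite inE eqxx.
by split=> // k ks; apply: hs; rewrite inE ks orbT.
Qed.

Lemma label_at t x p : t < N -> node x -> counter_at 0 (N.-1 - t) x ->
  (forall j : 'I_K, counter_at j.+1 (p j) x) ->
  holds_at (ALab (circular N w t p)) 0 x.
Proof.
have [_ _ _ Bn [Bi _]] := bound_rules_at.
elim: t x p => [|t IH] x p tN nx c0 cp.
  have p0 : p ord0 < N by case: (cp ord0).
  apply: (Bi _ x); split.
    have := @ones_at 0 _ x m nx isT c0 (leqnn m).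
    by rewrite ones_max subn0 ?eqxx ?prednK ?N_gt0.
  apply: letter_at => //; first by rewrite ltn_mod N_gt0.
  rewrite modnDml addSnnS prednK ?N_gt0 // modnDr modn_small //.
  exact: (cp ord0).
have [[y xy ny] [z xz nz] _] := edge_node nx.
(* Going back in time increments counter 0; [t.+1 < N] keeps the subtraction exact. *)
have time : shift N GoRight (N.-1 - t.+1) = N.-1 - t.
  by rewrite /= modn_small; move: tN; lia.
have dx i : cext I (inst i TTop) x by exact: cint_dom nx.
have cy0 : counter_at 0 (N.-1 - t) y.
  rewrite -time; apply: (@shift_at TTop RConf 0 GoRight _ x y _ dx) => //.
  by move=> i /loop_rules_at[_ []].
have cz0 : counter_at 0 (N.-1 - t) z.
  rewrite -time; apply: (@shift_at TTop RCell 0 GoRight _ x z _ dx) => //.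
  by move=> i /loop_rules_at[_ []].
have cy (j : 'I_K) : counter_at j.+1 N.-1 y.
  have [v cv] := counter_at_exists ny (ltn_ord j).
  rewrite -(full_at ny (ltn_ord j) cv.1 _ cv) // => i im.
  by have [_ _ H _] := loop_rules_at im; exact: H xy.
have Ly := IH y (fun=> N.-1) (ltnW tN) ny cy0 cy.
set c := circular N w t (fun=> N.-1) in Ly.
have cz (j : 'I_K) : counter_at j.+1 (shift N (label_dir c j) (p j)) z.
  apply: (@shift_at (TE RConf (TA (ALab c) Zero)) RCell _ _ _ x) => //.
    by move=> i /loop_rules_at[_ _ _ /(_ (c, j))].
  by move=> i; exists y.
have Lz := IH z _ (ltnW tN) nz cz0 cz.
apply: (Bn (c, _, _) x); split; first by exists y.
split.
  exists z => //; split; first exact: Lz.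
  apply/cext_scanned; split; first exact: cint_dom nz.
  move=> j; rewrite ffunE -ones_max; last by case: (cz j).
  exact: (ones_at nz (ltn_ord j) (cz j)).
have := @ones_at 0 _ x m nx isT c0 (leqnn m).
rewrite ones_max ?ltn_eqF //; move: tN; lia.
Qed.

Lemma accept_at x : node x -> holds_at AStart 0 x ->
  holds_at AAcc 0 x <-> @tm_accept M (circular N w N.-1 (fun=> N.-1)).1.
Proof.
move=> nx sx.
have c0 r : r <= K -> counter_at r (if r == 0 then 0 else N.-1) x.
  move=> rK; split=> [|i im]; first by case: ifP; rewrite ?prednK ?N_gt0.
  have [/(_ r rK) [_ [_ [_ [_ [_ [/(_ x sx) + _]]]]]] _ _ _] := loop_rules_at im.
  case: (eqVneq r 0) => _; first by rewrite /bit div0n.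
  by rewrite bit_max.
have L : holds_at (ALab (@circular M N w N.-1 (fun=> N.-1))) 0 x.
  apply: label_at => //; first by rewrite prednK ?N_gt0.
    by rewrite subnn; exact: (c0 0).
  by move=> j; exact: (c0 j.+1 (ltn_ord j)).
have [_ _ _ _ [_ /(_ (@circular M N w N.-1 (fun=> N.-1)))]] := bound_rules_at.
rewrite /accept_rule; case: ifP => acc H.
  by split=> // _; exact: H L.
by split=> // Ax; case: (H x); split.
Qed.

End Soundness.
(** * The intended interpretation *)

Section Canonical.
Local Open Scope classical_set_scope.

Definition ind_start : iname := [::].
Definition ind_true : iname := [:: true].
Definition ind_false : iname := [:: false].

Definition start_counters (r : nat) : nat := if r == 0 then 0 else N.-1.

(** An anonymous node is its own counter valuation, and [ind_start] is the only named node.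
    Successors and labels are thus functions of the valuation. *)
Definition valued (x : iname + (nat -> nat)) (v : nat -> nat) : Prop :=
  match x with
  | inl a => a = ind_start /\ v = start_counters
  | inr u => (forall r, u r < N) /\ v = u
  end.

Definition offset (v : nat -> nat) : nat := (v 1).+1 %% N.

Definition lab (v : nat -> nat) : label :=
  circular N w (N.-1 - v 0) (fun j : 'I_K => v j.+1).

Definition conf_child (v : nat -> nat) r : nat :=
  if r == 0 then shift N GoRight (v 0) else N.-1.

Definition cell_child (v : nat -> nat) r : nat :=
  if r is j.+1 then
    if insub j is Some j' then shift N (label_dir (lab (conf_child v)) j') (v r)
    else v r
  else shift N GoRight (v 0).

Definition prev_child (v : nat -> nat) r : nat :=
  if r == 1 then shift N GoLeft (v r) else v r.

Definition target q i (v : nat -> nat) : iname + (nat -> nat) :=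
  match q with
  | RConf => inr (conf_child v)
  | RCell => inr (cell_child v)
  | RPrev => inr (prev_child v)
  | RBit r => inl (if bit i (v r) then ind_true else ind_false)
  end.

Definition node_sem a i (v : nat -> nat) : Prop :=
  match a with
  | ANode => True
  | AAcc => tm_accept (lab v).1
  | ABeyond => size w <= offset v
  | APos => offset v = i
  | AInit s => letter w (offset v) = s
  | AOnes b r => ones i (v r) = b
  | ALab l => lab v = l
  | AStart => v = start_counters
  | _ => False
  end.

Definition atom_sem a i (x : iname + (nat -> nat)) : Prop :=
  match a with
  | ABool => x = inl ind_true \/ x = inl ind_false
  | ATrue => x = inl ind_true
  | AFalse => x = inl ind_false
  | _ => exists2 v, valued x v & node_sem a i v
  end.

Definition run_dom : set (iname + (nat -> nat)) :=
  [set x | [\/ x = inl ind_true, x = inl ind_false | exists v, valued x v]].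

Definition run_cint (A : cname) : set (iname + (nat -> nat)) :=
  [set x | exists a i, A = name (atom_code a) i /\ atom_sem a i x].

Definition run_rint (R : rname) : set ((iname + (nat -> nat)) * (iname + (nat -> nat))) :=
  [set xy | exists q i v, [/\ R = name (role_code q) i, valued xy.1 v & xy.2 = target q i v]].

Lemma valued_lt x v r : valued x v -> v r < N.
Proof.
case: x => [a [_ ->]|u [uN ->]] //; rewrite /start_counters.
by case: ifP; rewrite ?prednK ?N_gt0.
Qed.

Lemma valued_inj x v v' : valued x v -> valued x v' -> v = v'.
Proof. by case: x => [a [_ ->] [_ ->]|u [_ ->] [_ ->]]. Qed.

Lemma conf_valued v : (forall r, v r < N) -> valued (inr (conf_child v)) (conf_child v).
Proof.
move=> vN; split=> // r; rewrite /conf_child; case: ifP => _.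
  exact: shift_lt.
by rewrite prednK ?N_gt0.
Qed.

Lemma cell_valued v : (forall r, v r < N) -> valued (inr (cell_child v)) (cell_child v).
Proof.
move=> vN; split=> // -[|j]; first exact: shift_lt.
by rewrite /cell_child; case: insub => // j'; exact: shift_lt.
Qed.

Lemma prev_valued v : (forall r, v r < N) -> valued (inr (prev_child v)) (prev_child v).
Proof. by move=> vN; split=> // r; rewrite /prev_child; case: ifP => // _; exact: shift_lt. Qed.

Lemma target_dom q i x v : valued x v -> run_dom (target q i v).
Proof.
move=> xv; have vN r := valued_lt r xv; case: q => [|||r] /=.
- by apply: Or33; exists (conf_child v); exact: conf_valued.
- by apply: Or33; exists (cell_child v); exact: cell_valued.
- by apply: Or33; exists (prev_child v); exact: prev_valued.
- by case: (bit i (v r)); [exact: Or31 | exact: Or32].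
Qed.

Lemma run_dom_nonempty : run_dom !=set0.
Proof. by exists (inl ind_true); exact: Or31. Qed.

Lemma run_cint_dom A : run_cint A `<=` run_dom.
Proof.
move=> x [a [i [_]]]; case: a => [||||||||s|b r|l] /=;
  try by case=> v xv _; apply: Or33; exists v.
- by case=> ->; [exact: Or31 | exact: Or32].
- by move=> ->; exact: Or31.
- by move=> ->; exact: Or32.
Qed.

Lemma run_rint_dom R : run_rint R `<=` run_dom `*` run_dom.
Proof.
move=> [x y] [q [i [v [_ /= xv ->]]]]; split=> /=; last exact: target_dom xv.
by apply: Or33; exists v.
Qed.

Definition run_interp : interp := Interp run_dom_nonempty run_cint_dom run_rint_dom.

Local Notation J := run_interp.

Lemma cext_atom a i (x : elt J) : cint J (name (atom_code a) i) x <-> atom_sem a i x.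
Proof.
split=> [[a' [i' [/name_inj[/atom_code_inj <- <-]]]] //|H].
by exists a, i.
Qed.


Lemma cext_TAnd C D i (x : elt J) : cext J (inst i (TAnd C D)) x <->
  cext J (inst i C) x /\ cext J (inst i D) x.
Proof. by []. Qed.

Lemma rint_role q i (x y : elt J) : rint J (name (role_code q) i) (x, y) <->
  exists2 v, valued x v & y = target q i v.
Proof.
split=> [[q' [i' [v [/name_inj[/role_code_inj <- <-] /= xv ->]]]]|[v xv ->]].
  by exists v.
by exists q, i, v.
Qed.

Definition node_atom a :=
  match a with ABool | ATrue | AFalse => false | _ => true end.

Lemma cext_TA a (na : node_atom a) s i (x : elt J) : cext J (inst i (TA a s)) x <->
  exists2 v, valued x v & node_sem a (subscript_val s i) v.
Proof.
transitivity (atom_sem a (subscript_val s i) x); first exact: cext_atom.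
by case: a na.
Qed.

Lemma cext_TE q C i (x : elt J) : cext J (inst i (TE q C)) x <->
  exists2 v, valued x v & cext J (inst i C) (target q 0 v).
Proof.
split=> [[y /rint_role[v xv ->] Cy]|[v xv Cy]]; first by exists v.
by exists (target q 0 v) => //; apply/rint_role; exists v.
Qed.

Lemma cext_TBit b r i (x : elt J) : cext J (inst i (TBit b r)) x <->
  exists2 v, valued x v & bit i (v r) = b.
Proof.
split=> [[y /rint_role[v xv ->]]|[v xv <-]].
  move=> By; exists v => //; move: By.
  by case: b => /cext_atom /=; case: bit.
exists (target (RBit r) i v); first by apply/rint_role; exists v.
by case E: (bit i (v r)); apply/cext_atom; rewrite /= E.
Qed.

Section At.
Variables (x : elt J) (v : nat -> nat).
Hypothesis xv : valued x v.

Lemma TA_at a s i : cext J (inst i (TA a s)) x <-> node_sem a (subscript_val s i) v.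
Proof.
case na: (node_atom a).
  rewrite cext_TA //; split=> [[v' xv']|]; last by exists v.
  by rewrite (valued_inj xv' xv).
split; last by case: a na.
move/cext_atom; move: xv; case: a na => //= _ + e.
- by case: e => -> [].
- by rewrite e => -[].
- by rewrite e => -[].
Qed.

Lemma TE_at q C i : cext J (inst i (TE q C)) x <-> cext J (inst i C) (target q 0 v).
Proof.
rewrite cext_TE; split=> [[v' xv']|]; last by exists v.
by rewrite (valued_inj xv' xv).
Qed.

Lemma TBit_at b r i : cext J (inst i (TBit b r)) x <-> bit i (v r) = b.
Proof.
rewrite cext_TBit; split=> [[v' xv']|]; last by exists v.
by rewrite (valued_inj xv' xv).
Qed.

End At.

(** Once the target carries the shifted counter, [succ_bits] rules out each forbidden combination of
    digits. *)
Lemma shift_rules_sat G q r d i : i < m ->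
  (forall x v, valued x v -> cext J (inst i G) x ->
     exists2 u, valued (target q 0 v) u & u r = shift N d (v r)) ->
  for_all (tsat J i) (shift_rules G q r d).
Proof.
move=> im H; apply/for_all_map => -[b o] _ x.
case: d H => H; rewrite [(shift_rule _ _ _ _ _).1]/=;
  move/cext_TAnd => [Gx /cext_TAnd[Hx Hq]]; exfalso.
- have [v xv vb] := (cext_TBit _ _ _ _).1 Hx; have [u yu uE] := H x v xv Gx.
  move/(TE_at xv)/cext_TAnd: Hq => [/(TA_at yu) /= uo /(TBit_at yu) ub].
  have vN := valued_lt r xv; have uN := valued_lt r yu.
  have := (succ_bits uN vN).2 ((shift_leftE vN uN).2 uE) i im.
  by rewrite vb ub uo; case: (b); case: (o).
- have [v xv vb] := (cext_TBit _ _ _ _).1 Hx; have [u yu uE] := H x v xv Gx.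
  move/(TE_at xv)/(TBit_at yu): Hq; rewrite uE vb.
  by case: (b).
- move/cext_TAnd: Hx => [Ho Hx].
  have [v xv vb] := (cext_TBit _ _ _ _).1 Hx; have [u yu uE] := H x v xv Gx.
  move/(TE_at xv)/(TBit_at yu): Hq; move/(TA_at xv): Ho => /= vo.
  by rewrite uE /= bit_mod // bitS vb vo; case: (b); case: (o).
Qed.

Lemma conf_at x v : valued x v -> valued (target RConf 0 v) (conf_child v).
Proof. by move=> xv; apply: conf_valued => r; exact: valued_lt xv. Qed.

Lemma cell_at x v : valued x v -> valued (target RCell 0 v) (cell_child v).
Proof. by move=> xv; apply: cell_valued => r; exact: valued_lt xv. Qed.

Lemma prev_at x v : valued x v -> valued (target RPrev 0 v) (prev_child v).
Proof. by move=> xv; apply: prev_valued => r; exact: valued_lt xv. Qed.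

Lemma counter_rules_sat i r : i < m -> for_all (tsat J i) (counter_rules r).
Proof.
move=> im; split; [|split; [|split; [|split; [|split; [|split=> //]]]]] => x;
  rewrite [(_, _).1]/= [(_, _).2]/=.
- move/(cext_TA (a := ANode) isT) => [v xv _].
  exists (target (RBit r) i v); first by apply/(rint_role (RBit r)); exists v.
  by apply/cext_atom => /=; case: bit; [left | right].
- by move/cext_TAnd => [/cext_TBit[v xv vb] /(TBit_at xv)]; rewrite vb.
- move/cext_TAnd => [/(cext_TA (a := AOnes _ _) isT)[v xv vo] /(TBit_at xv) vb].
  by apply/(TA_at xv) => //=; rewrite onesS vb andbT.
- move=> /(cext_TA (a := AOnes _ _) isT)[v xv vo].
  by apply/(TA_at xv) => //=; move: vo => /= ; rewrite onesS => ->.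
- move=> /cext_TBit[v xv vb].
  by apply/(TA_at xv) => //=; rewrite onesS vb andbF.
- move/(cext_TA (a := AStart) isT) => [v xv vs]; apply/cext_TBit; exists v => //.
  rewrite vs /start_counters; case: eqP => _ /=; first by rewrite /bit div0n.
  by rewrite bit_max.
Qed.

Lemma loop_rules_sat i : i < m -> for_all (tsat J i) run_loop_rules.
Proof.
move=> im; apply/for_all_cat; split.
  by apply/for_all_flatten => r _; exact: counter_rules_sat.
apply/for_all_cat; split.
  apply/for_all_cat; split; last (apply/for_all_cat; split);
    apply: shift_rules_sat => // x v xv _.
  - by exists (conf_child v); first exact: conf_at xv.
  - by exists (cell_child v); first exact: cell_at xv.
  - by exists (prev_child v); first exact: prev_at xv.
apply/for_all_cat; split.
  apply/for_all_map => j; rewrite mem_iota => /andP[j1 _] x; rewrite [(_, _).1]/=.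
  move/cext_TE => [v xv /(TBit_at (conf_at xv))].
  by rewrite /conf_child gtn_eqF // bit_max.
apply/for_all_flatten => -[l j] _; apply: shift_rules_sat => // x v xv.
move/(TE_at xv)/(TA_at (conf_at xv)) => /= lE.
exists (cell_child v); first exact: cell_at xv.
by rewrite /= insubT ?ltn_ord // lE => ?; congr (shift N (label_dir l _) _); exact: val_inj.
Qed.
Lemma offset_prev v : (forall r, v r < N) -> offset (prev_child v) = v 1.
Proof.
move=> vN; rewrite /offset /prev_child eqxx.
by rewrite -((shift_leftE (v := shift N GoLeft (v 1)) (vN 1) (shift_lt _ (vN 1))).2 erefl).
Qed.

Lemma lab_next v : (forall r, v r < N) -> v 0 != N.-1 ->
  lab v = next_label (lab (conf_child v)) (lab (cell_child v))
            [ffun j : 'I_K => cell_child v j.+1 == N.-1].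
Proof.
move=> vN v0; have v0N : (v 0).+1 < N.
  by have := vN 0; move: v0 N_gt0; lia.
have time : N.-1 - v 0 = (N.-1 - (v 0).+1).+1 by move: v0N; lia.
have cE (j : 'I_K) : cell_child v j.+1 = shift N (label_dir (lab (conf_child v)) j) (v j.+1).
  by rewrite /= insubT // => ?; congr (shift N (label_dir _ _) _); exact: val_inj.
rewrite {1}/lab time [LHS]/=.
have -> : circular N w (N.-1 - (v 0).+1) (fun=> N.-1) = lab (conf_child v).
  by rewrite /lab /conf_child /= modn_small.
congr next_label; last by apply/ffunP => j; rewrite !ffunE cE.
rewrite {2}/lab [cell_child v 0]/= modn_small //.
by congr circular; apply/funext => j; rewrite cE.
Qed.

Lemma bound_rules_sat : size w < N -> for_all (tsat J m) run_bound_rules.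
Proof.
move=> wN; apply/for_all_cat; split.
  split; [|split; [|split; [|split; [|split; [|split=> //]]]]] => x;
    rewrite [(_, _).1]/= [(_, _).2]/=.
  - move/(cext_TA (a := ANode) isT) => [v xv _].
    by apply/cext_TE; exists v => //; apply/(TA_at (conf_at xv)).
  - move/(cext_TA (a := ANode) isT) => [v xv _].
    by apply/cext_TE; exists v => //; apply/(TA_at (cell_at xv)).
  - move/(cext_TA (a := ANode) isT) => [v xv _].
    by apply/cext_TE; exists v => //; apply/(TA_at (prev_at xv)).
  - move/(cext_TA (a := AOnes _ _) isT) => [v xv /=].
    rewrite ones_max ?(valued_lt _ xv) // => /eqP v1; apply: (TA_at xv APos Zero m).2.
    by rewrite /= /offset v1 prednK ?N_gt0 // modnn.
  (* Counter 1 is not full, so the offset is that of the left neighbour plus one, without a wrap to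
     0. *)
  - move/cext_TAnd => [/cext_TE[v xv /(TA_at (prev_at xv)) H] /(TA_at xv) vo].
    apply/(TA_at xv); have vN r := valued_lt r xv.
    move: H vo => /= wv; rewrite ones_max // => v1; move: wv.
    rewrite offset_prev // => wv; rewrite /offset modn_small ?(leqW wv) //.
    by have := vN 1; move: v1 N_gt0; lia.
  - move/(cext_TA (a := ABeyond) isT) => [v xv vo]; apply/(TA_at xv) => /=.
    by rewrite /letter nth_default // size_map.
apply/for_all_cat; split.
  apply/for_all_map => r _ x; rewrite [(_, _).1]/= [(_, _).2]/=.
  by move/(cext_TA (a := ANode) isT) => [v xv _]; apply/(TA_at xv); exact: ones0.
apply/for_all_cat; split.
  apply/for_all_map => -[[c d] h] _ x; rewrite [(next_rule _).1]/= [(next_rule _).2]/=.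
  move/cext_TAnd => [/cext_TE[v xv /(TA_at (conf_at xv)) cE]].
  move/cext_TAnd => [/(TE_at xv)/cext_TAnd[/(TA_at (cell_at xv)) dE /cext_scanned[_ hE]]].
  move/(TA_at xv) => v0; apply/(TA_at xv); rewrite /= in cE dE v0 *.
  have vN r : v r < N by exact: valued_lt xv.
  rewrite lab_next //; last by move: v0; rewrite ones_max // => ->.
  rewrite cE dE; congr next_label; apply/ffunP => j; rewrite ffunE.
  have := (TA_at (cell_at xv) (AOnes (h j) j.+1) Here m).1 (hE j) => /= <-.
  by rewrite ones_max //; case: (cell_valued vN) => /(_ j.+1).
apply/for_all_cat; split.
  apply/for_all_map => s _ x; rewrite [(init_rule _).1]/= [(init_rule _).2]/=.
  move/cext_TAnd => [/(cext_TA (a := AOnes _ _) isT)[v xv v0] /(TA_at xv) vs].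
  apply/(TA_at xv); rewrite /= in v0 vs *; rewrite /lab; move: v0.
  by rewrite ones_max ?(valued_lt _ xv) // => /eqP ->; rewrite subnn /= -vs.
apply/for_all_map => l _; rewrite /accept_rule; case: ifP => acc x;
  rewrite [(_, _).1]/= [(_, _).2]/=.
  by move/(cext_TA (a := ALab _) isT) => [v xv vl]; apply/(TA_at xv); rewrite /= in vl *; rewrite vl.
move/cext_TAnd => [/(cext_TA (a := ALab _) isT)[v xv vl] /(TA_at xv)].
by rewrite /= in vl *; rewrite vl acc.
Qed.

Lemma run_model : size w < N -> family_model J run_rules m w.
Proof.
move=> wN; split.
- by move=> i im; exact: loop_rules_sat.
- exact: bound_rules_sat.
- move=> p pw; split; [|split=> //] => x; rewrite [(_, _).1]/= [(_, _).2]/=.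
    move/cext_TE => [v xv /(TA_at (prev_at xv)) v1]; apply/(TA_at xv); move: v1 => /=.
    rewrite offset_prev => [v1|r]; last exact: valued_lt xv.
    (* As [p < size w < N], the offset [p.+1] does not wrap around. *)
    by rewrite /offset v1 modn_small // (leq_ltn_trans pw).
  move/(cext_TA (a := APos) isT) => [v xv vp]; apply/(TA_at xv); rewrite /= in vp *.
  by rewrite vp /letter (nth_map false).
- split=> // x; rewrite [(_, _).1]/= [(_, _).2]/=.
  move/(cext_TA (a := APos) isT) => [v xv vp]; apply/(TA_at xv); rewrite /= in vp *.
  by rewrite vp.
Qed.

End Canonical.

(** * The reduction *)

Definition soft_inclusion : inclusion := (CName (name (atom_code ABool) 0), CBot).

Definition run_assertions : seq assertion :=
  [:: AConcept (name (atom_code ANode) 0) ind_start;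
      AConcept (name (atom_code AStart) 0) ind_start;
      AConcept (name (atom_code ABool) 0) ind_true;
      AConcept (name (atom_code ABool) 0) ind_false;
      AConcept (name (atom_code ATrue) 0) ind_true;
      AConcept (name (atom_code AFalse) 0) ind_false].

Definition run_query : iquery :=
  QConcept (name (atom_code AAcc) 0) (TInd ind_start).

Definition run_wkb : wkb :=
  family_wkb run_rules (soft_inclusion, Some 1) [seq (a, None) | a <- run_assertions] m w.

Lemma uniq_run_assertions : uniq run_assertions.
Proof.
rewrite /= !inE !negb_or; do !(apply/andP; split) => //;
  by apply/eqP => -[] // /name_inj[/atom_code_inj].
Qed.

Lemma wf_run_wkb : wf_wkb run_wkb.
Proof. exact: wf_family_wkb uniq_run_assertions. Qed.

Local Notation inds := (input_inds run_wkb run_query).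

Definition bool_closed (I : interp) : Prop :=
  forall x, holds_at ABool 0 x -> holds_at (I := I) ATrue 0 x \/ holds_at AFalse 0 x.

Lemma vio_soft I : vio_inclusion I soft_inclusion = cint I (name (atom_code ABool) 0).
Proof.
apply/seteqP; split=> [x []//|x Bx]; split=> //; split; last by [].
exact: cint_dom Bx.
Qed.

(** Finite cost enforces the strict axioms, so the cost is the number of elements of [Bool]. The
    assertions place two distinct individuals in it, and the bound leaves no room for a third. *)
Lemma low_cost I : (cost run_wkb I <= (Posz 2)%:E)%E ->
  [/\ cost run_wkb I = (Posz 2)%:E, family_model I run_rules m w, bool_closed I,
      node (inl ind_start : elt I) & holds_at AStart 0 (inl ind_start : elt I)].
Proof.
move=> le; have [sL sA] := strict_model_cost le.
have cE : cost run_wkb I = ecard (cint I (name (atom_code ABool) 0)).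
  by rewrite -vio_soft; apply: cost_strict_model.
have mem a : a \in run_assertions -> sat_assertion I a by exact: sA.
have Bt : holds_at ABool 0 (inl ind_true : elt I) by apply: (mem (AConcept _ _)); rewrite !inE eqxx ?orbT.
have Bf : holds_at ABool 0 (inl ind_false : elt I) by apply: (mem (AConcept _ _)); rewrite !inE eqxx ?orbT.
have T : holds_at ATrue 0 (inl ind_true : elt I) by apply: (mem (AConcept _ _)); rewrite !inE eqxx ?orbT.
have F : holds_at AFalse 0 (inl ind_false : elt I) by apply: (mem (AConcept _ _)); rewrite !inE eqxx ?orbT.
have tf : (inl ind_true : elt I) <> inl ind_false by [].
have BE : cint I (name (atom_code ABool) 0) = [set inl ind_true; inl ind_false]%classic.
  by apply: (ecard_le2 tf Bt Bf); rewrite -cE.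
split.
- by rewrite cE BE ecard_pair.
- exact/family_inclusions_sat.
- by move=> x; rewrite /holds_at BE => -[->|->]; [left | right].
- by apply: (mem (AConcept _ _)); rewrite !inE eqxx ?orbT.
- by apply: (mem (AConcept _ _)); rewrite !inE eqxx ?orbT.
Qed.

Lemma run_cost : size w < N -> cost run_wkb run_interp = (Posz 2)%:E.
Proof.
move=> wN; have -> : cost run_wkb run_interp = ecard (cint run_interp (name (atom_code ABool) 0)).
  rewrite -vio_soft; apply: cost_strict_model; split.
    exact/family_inclusions_sat/run_model.
  apply/for_all_mem; rewrite /=; do !split => //; apply/cext_atom => /=; try by [| left | right].
  - by exists start_counters.
  - by exists start_counters.
have -> : cint run_interp (name (atom_code ABool) 0) =
    [set inl ind_true; inl ind_false]%classic.
  by apply/seteqP; split=> x; [move/cext_atom | move=> ?; apply/cext_atom].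
by rewrite ecard_pair.
Qed.

Lemma run_standard_names : standard_names inds run_interp.
Proof.
move=> a; rewrite /input_inds /= !inE => H; rewrite /dom /=.
have : [\/ a = ind_true, a = ind_false | a = ind_start].
  by do !case/orP: H => H; move/eqP: H => ->; by [apply: Or31 | apply: Or32 | apply: Or33].
case=> ->; [exact: Or31 | exact: Or32 |].
by apply: Or33; exists start_counters.
Qed.

Lemma run_is_optc : size w < N -> is_optc inds run_wkb (Posz 2)%:E.
Proof.
move=> wN; split; first by exists run_interp; [exact: run_standard_names | exact: run_cost].
move=> I _; case: (Order.TotalTheory.leP (Posz 2)%:E%E (cost run_wkb I)) => // lt.
have [E _ _ _ _] := low_cost (Order.POrderTheory.ltW lt).
by rewrite E Order.POrderTheory.ltxx in lt.
Qed.

Lemma optimal_run : size w < N -> optimal inds run_wkb run_interp.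
Proof.
move=> wN; split; first exact: run_standard_names.
by rewrite run_cost //; exact: run_is_optc.
Qed.

Lemma sat_run_query I : sat_query I run_query <-> holds_at AAcc 0 (inl ind_start : elt I).
Proof.
split=> [[pi [_ pa]]|H]; first by rewrite /= (pa ind_start) // inE.
exists (fun=> inl ind_start); split=> //.
- by move=> t _; exact: cint_dom H.
- by move=> a; rewrite inE => /eqP[->].
Qed.

Lemma optimal_sat_query I : size w < N -> optimal inds run_wkb I ->
  sat_query I run_query <-> tm_accept (@circular M N w N.-1 (fun=> N.-1)).1.
Proof.
move=> wN [sI [_ /(_ _ run_standard_names)]]; rewrite run_cost // => le.
have [_ model closed na sa] := low_cost le.
by rewrite sat_run_query; exact: accept_at.
Qed.

(** All optimal interpretations agree on the query, and [run_interp] is one of them; so possible and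
    certain entailment coincide. *)
Lemma entails_run : size w < N ->
  (entails_possible run_wkb run_query <->
     tm_accept (@circular M N w N.-1 (fun=> N.-1)).1) /\
  (entails_certain run_wkb run_query <->
     tm_accept (@circular M N w N.-1 (fun=> N.-1)).1).
Proof.
move=> wN; have opt := optimal_run wN; split; split.
- by case=> I oI /(optimal_sat_query wN oI).
- by move=> acc; exists run_interp => //; apply/(optimal_sat_query wN opt).
- by move/(_ _ opt)/(optimal_sat_query wN opt).
- by move=> acc I oI; apply/(optimal_sat_query wN oI).
Qed.

End Reduction.

Lemma time_bound c d n :
  2 ^ (c * n ^ d + c) + n < 2 ^ bound c d n.
Proof.
have -> : bound c d n = (c * n ^ d + c) + n.+1 by rewrite /bound mulnS; lia.
rewrite [ltnRHS]expnD; set T := 2 ^ (_ + _); have T0 : 0 < T by rewrite expn_gt0.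
(* The power [2 ^ n.+1] is at least [n.+2], and [T * n.+2] is at least [T + n.+1]. *)
apply: leq_trans _ (leq_mul (leqnn T) (ltn_expl n.+1 (ltnSn 1))).
by rewrite mulnS -addnS leq_add2l leq_pmull.
Qed.

Lemma run_correct M c d (L : language) w :
  decides_in_time M L (fun n => 2 ^ (c * n ^ d + c)) ->
  let K := run_wkb M (bound c d (size w)) w in
  (entails_possible K (run_query M) <-> L w) /\
  (entails_certain K (run_query M) <-> L w).
Proof.
move=> /(_ w) [halt acc]; have le := time_bound c d (size w).
set T := 2 ^ (c * size w ^ d + c) in halt acc le.
have wN : size w < 2 ^ bound c d (size w) by apply: leq_ltn_trans le; exact: leq_addl.
have [Ep Ec] := entails_run M wN.
rewrite /= Ep Ec (circular_final (n := (2 ^ bound c d (size w)).-1) _ _ halt) //.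
- exact: ltnW.
- by move: le; lia.
Qed.

Theorem theorem6 (u : weight_coding) :
  exptime_hard (iq_possible u) /\ exptime_hard (iq_certain u).
Proof.
have red (P : wkb -> iquery -> Prop) L M c d :
    (forall w, P (run_wkb M (bound c d (size w)) w) (run_query M) <-> L w) ->
    polytime_reducible L [set w | exists K q,
      [/\ wf_wkb K, w = enc_instance u K q & P K q]]%classic.
  move=> H; exists (fun w => enc_instance u (run_wkb M (bound c d (size w)) w) (run_query M)).
    exact: polytime_family_wkb.
  (* By unique readability the instance decoded from the word is the constructed one. *)
  move=> w; split=> [/H Lw|[K [q [_ /enc_instance_inj[<- <-]]]]]; last by move/H.
  exists (run_wkb M (bound c d (size w)) w), (run_query M); split=> //.
  exact: wf_run_wkb.
by split=> L [M [c [d dec]]]; apply: (@red _ L M c d) => w;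
  have [? ?] := run_correct w dec.
Qed.
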